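(* Let $k$ be a positive integer. (1) $C^{ab\,\Omega}_{1/k}(\mathcal I_{k,\delta})=\mathcal H_{k,\Omega}$, with $C^{ab\,\Omega}_{1/k}(\theta^0_m)=\theta_m$. (2) The function $\nu_{1/k}$ satisfies $\nu_{1/k}(z+e_j)=\nu_{1/k}(z)$ and $\nu_{1/k}(z+\Omega\delta e_j)=|\exp(-2\pi ikz_j\delta_j-\pi ik\Omega_{jj}\delta_j^2)|^{-2}\nu_{1/k}(z)$ for $j=1,\dots,l$; i.e. it is the pull-back to $\mathbb C^l$ of a hermitian structure on the line bundle $L_1^k$ over $M$ defined by the factors of automorphy $e(e_j,z)=1$, $e(\Omega\delta e_j,z)=\exp(-2\pi ikz_j\delta_j-\pi ik\Omega_{jj}\delta_j^2)$. (3) Equip $\mathcal H_{k,\Omega}$ with $$\langle\theta,\theta'\rangle=\int_{[0,1]^l\times[0,1]^l}\overline{\theta(\eta+\Omega\delta\xi)}\,\theta'(\eta+\Omega\delta\xi)\,(2k)^{l/2}(\det\Omega_2)^{1/2}(\det\delta)\,e^{-2\pi k(\delta\xi)^T\Omega_2(\delta\xi)}\,d\eta\,d\xi .$$ Then $C^{ab\,\Omega}_{1/k}:(\mathcal I_{k,\delta},(\cdot,\cdot))\to(\mathcal H_{k,\Omega},\langle\cdot,\cdot\rangle)$ is unitary.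
   Context: Let $l\ge1$, $\Omega$ a complex symmetric $l\times l$ matrix with positive definite imaginary part $\Omega_2=\mathrm{Im}\,\Omega$, and $\delta=\mathrm{diag}(\delta_1,\dots,\delta_l)$ with positive integers $\delta_1=1$, $\delta_i\mid\delta_{i+1}$. Let $e_j$ be the standard basis of $\mathbb C^l$, $\Lambda=\mathbb Z^l\oplus\Omega\delta\mathbb Z^l$, $M=\mathbb C^l/\Lambda$ (an abelian variety with polarization of type $\delta$). For $m\in\mathbb Z^l$ (taken modulo $k\delta\mathbb Z^l$), $\theta_m(z)=\sum_{p\in\mathbb Z^l}\exp\big(\pi i(m+k\delta p)\cdot\tfrac{\Omega}{k}(m+k\delta p)+2\pi i(m+k\delta p)\cdot z\big)$, viewed as holomorphic functions on $\mathbb C^l/\mathbb Z^l\cong(\mathbb C^* )^l$; $\mathcal H_{k,\Omega}$ is their span (level $k$ theta functions). On $(S^1)^l=\mathbb R^l/\mathbb Z^l$ let $\theta^0_m(x)=\sum_{p\in\mathbb Z^l}e^{2\pi i(m+k\delta p)\cdot x}$ (distributions), and let $\mathcal I_{k,\delta}$ be their span with the inner product $(\cdot,\cdot)$ making $\{\theta^0_m: m\in\mathbb Z^l/k\delta\mathbb Z^l\}$ orthonormal. For $t>0$, $C^{ab\,\Omega}_t$ maps a distribution $\sum_{\mu\in\mathbb Z^l}b_\mu e^{2\pi i\mu\cdot x}$ (polynomially bounded coefficients) to the holomorphic function $\sum_\mu b_\mu e^{\pi it\,\mu\cdot\Omega\mu}e^{2\pi i\mu\cdot z}$ on $(\mathbb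 C^* )^l$ (the analytic continuation of $e^{\pi t\Delta}$ applied to it, $\Delta=-\frac{i}{4\pi^2}\sum\Omega_{jj'}\partial_{x_j}\partial_{x_{j'}}$). Let $\nu_t(z)=(2/t)^{l/2}(\det\Omega_2)^{-1/2}\exp\big(\frac{\pi}{2t}(z-\bar z)^T\Omega_2^{-1}(z-\bar z)\big)$. *)

(* Defs.v *)
(* MathComp + MathComp-Analysis, complex numbers R[i] from
   mathcomp-real-closed. *)
From HB Require Import structures.
From mathcomp Require Import all_boot all_order all_algebra.
From mathcomp Require Import all_classical all_reals all_analysis.
From mathcomp Require Import complex.
Set Implicit Arguments. Unset Strict Implicit. Unset Printing Implicit Defensive.
Import Order.TTheory GRing.Theory Num.Theory.
Import numFieldNormedType.Exports numFieldTopology.Exports.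
Local Open Scope classical_set_scope.
Local Open Scope complex_scope.
Local Open Scope ring_scope.

Section ThetaDefs.
Variable R : realType.
Local Notation C := (R[i]).

(* complex exponential *)
Definition cexp (z : C) : C :=
  (expR (complex.Re z))%:C * ((cos (complex.Im z))%:C + 'i * (sin (complex.Im z))%:C).

Variable l : nat.

(* standard pairings on Z^l, C^l *)
Definition dotZC (mu : 'I_l -> int) (z : 'I_l -> C) : C :=
  \sum_(i < l) (mu i)%:~R * z i.
Definition quadZ (A : 'M[C]_l) (mu : 'I_l -> int) : C :=
  \sum_(i < l) \sum_(j < l) (mu i)%:~R * A i j * (mu j)%:~R.

(* Sum over the box {-N..N}^l of Z^l, and the sum over all of Z^l defined as the
   limit of these symmetric box partial sums (all series used below converge
   absolutely, so this is the usual value of the series). *)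
Definition boxsum (N : nat) (F : ('I_l -> int) -> C) : C :=
  \sum_(q : {ffun 'I_l -> 'I_(2 * N + 1)}) F (fun i => (q i)%:Z - N%:Z).
Definition zsum (F : ('I_l -> int) -> C) : C :=
  limn ((fun N => boxsum N F) : nat -> (C^o)).

(* the vector m + k delta p *)
Definition latpt (k : nat) (delta : 'I_l -> nat) (m p : 'I_l -> int) : 'I_l -> int :=
  fun i => m i + (k * delta i)%:Z * p i.

(* level k theta functions theta_m, as functions on C^l (Z^l-periodic) *)
Definition theta (k : nat) (delta : 'I_l -> nat) (Om : 'M[C]_l)
    (m : 'I_l -> int) (z : 'I_l -> C) : C :=
  zsum (fun p => let mu := latpt k delta m p in
         cexp (pi%:C * 'i * (k%:R)^-1 * quadZ Om mu + 2%:R * pi%:C * 'i * dotZC mu z)).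

(* A distribution sum_mu b_mu e^{2 pi i mu.x} on (S^1)^l is represented by its
   coefficient function b : Z^l -> C.  theta^0_m has coefficients the indicator
   of m + k delta Z^l. *)
Definition theta0 (k : nat) (delta : 'I_l -> nat) (m : 'I_l -> int) :
    ('I_l -> int) -> C :=
  fun mu => if [forall i, ((k * delta i)%:Z %| (mu i - m i))%Z] then 1 else 0.

(* C^{ab Omega}_t *)
Definition Cab (Om : 'M[C]_l) (t : R) (b : ('I_l -> int) -> C) : ('I_l -> C) -> C :=
  fun z => zsum (fun mu => b mu * cexp (pi%:C * 'i * t%:C * quadZ Om mu)
                                * cexp (2%:R * pi%:C * 'i * dotZC mu z)).

(* I_{k,delta} = span of the theta^0_m *)
Definition Ispace (k : nat) (delta : 'I_l -> nat) (b : ('I_l -> int) -> C) : Prop :=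
  exists s : seq (('I_l -> int) * C),
    b = fun mu => \sum_(x <- s) x.2 * theta0 k delta x.1 mu.

(* H_{k,Omega} = span of the theta_m *)
Definition Hspace (k : nat) (delta : 'I_l -> nat) (Om : 'M[C]_l)
    (f : ('I_l -> C) -> C) : Prop :=
  exists s : seq (('I_l -> int) * C),
    f = fun z => \sum_(x <- s) x.2 * theta k delta Om x.1 z.

(* the inner product (.,.) on I_{k,delta} making {theta^0_m : m in Z^l/k delta Z^l}
   orthonormal: sum over the fundamental domain prod_i [0, k delta_i) *)
Definition dmax (delta : 'I_l -> nat) : nat := \max_(i < l) delta i.
Definition ipI (k : nat) (delta : 'I_l -> nat) (b b' : ('I_l -> int) -> C) : C :=
  \sum_(q : {ffun 'I_l -> 'I_(k * dmax delta)} | [forall i, (q i < k * delta i)%N])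
     (b (fun i => (q i)%:Z))^* * b' (fun i => (q i)%:Z).

(* Omega_2 = Im Omega *)
Definition Omega2 (Om : 'M[C]_l) : 'M[R]_l := map_mx (@complex.Im R) Om.

(* nu_t *)
Definition nu (Om : 'M[C]_l) (t : R) (z : 'I_l -> C) : C :=
  ((2 / t) `^ (l%:R / 2))%:C * ((\det (Omega2 Om)) `^ (- (1 / 2)))%:C *
  cexp (pi%:C / (2 * t)%:C *
        \sum_(i < l) \sum_(j < l)
           (z i - (z i)^*) * ((invmx (Omega2 Om)) i j)%:C * (z j - (z j)^*)).

(* iterated Lebesgue integral over the unit cube [0,1]^n, variables as a list *)
Fixpoint boxint (n : nat) (F : seq R -> R) : R :=
  match n with
  | 0%N => F [::]
  | n'.+1 => Rintegral lebesgue_measure `[0%R, 1%R]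
               (fun x => boxint n' (fun s => F (x :: s)))
  end.

(* the inner product <.,.> on H_{k,Omega}: integral over
   (eta, xi) in [0,1]^l x [0,1]^l *)
Definition ipH_integrand (k : nat) (delta : 'I_l -> nat) (Om : 'M[C]_l)
    (f g : ('I_l -> C) -> C) (se sx : seq R) : C :=
  let eta := fun i : 'I_l => nth 0 se i in
  let xi := fun i : 'I_l => nth 0 sx i in
  let w := fun i : 'I_l =>
     (eta i)%:C + \sum_(j < l) Om i j * (delta j)%:R * (xi j)%:C in
  let dxi := fun i : 'I_l => (delta i)%:R * xi i in
  (f w)^* * g w *
  ((2 * k%:R) `^ (l%:R / 2) * (\det (Omega2 Om)) `^ (1 / 2)
   * (\prod_(i < l) delta i)%:R
   * expR (- (2 * pi * k%:R) *
           \sum_(i < l) \sum_(j < l) dxi i * Omega2 Om i j * dxi j))%:C.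

Definition ipH (k : nat) (delta : 'I_l -> nat) (Om : 'M[C]_l)
    (f g : ('I_l -> C) -> C) : C :=
  (boxint l (fun se => boxint l (fun sx =>
      complex.Re (ipH_integrand k delta Om f g se sx))))%:C
  + 'i * (boxint l (fun se => boxint l (fun sx =>
      complex.Im (ipH_integrand k delta Om f g se sx))))%:C.

(* unit vector e_j in C^l *)
Definition evec (j : 'I_l) : 'I_l -> C := fun i => (i == j)%:R.

End ThetaDefs.

Arguments theta0 {R l}.
Arguments evec {R l}.

(* Main.v *)
(* The idea: Cab multiplies the Fourier coefficient b_mu by exp (pi i mu.Om mu / k),
   and theta_m collects the frequencies of the class m + k delta Z^l; since Im Om
   is positive definite, all series converge absolutely and can be regrouped
   freely, which gives (1).  Part (2) is a completion of the square in
   y^T (Im Om)^-1 y at y + delta_j (Im Om) e_j.  For (3), on the fundamental cell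
   z = eta + Om delta xi the integral over eta makes the exponentials orthogonal,
   and the one of frequency mu has squared norm
     h_mu = c * int_[0,1]^l exp (-2 pi k q(delta xi + mu / k)) dxi,  q = Im Om.
   Over a class mu = m + k delta p, p in Z^l, the cells tile R^l, so that the h_mu
   add up to a full Gaussian integral, which the weight normalizes to 1. *)
Require Import Defs.
From HB Require Import structures.
From mathcomp Require Import all_boot all_order all_algebra.
From mathcomp Require Import all_classical all_reals all_analysis.
From mathcomp Require Import finmap complex zify ring lra.
Set Implicit Arguments. Unset Strict Implicit. Unset Printing Implicit Defensive.
Import Order.TTheory GRing.Theory Num.Theory.
Import numFieldNormedType.Exports numFieldTopology.Exports.
Local Open Scope classical_set_scope.
Local Open Scope complex_scope.
Local Open Scope ring_scope.

(** * Unconditional sums *)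

(** Two limits shape the development. [boxint] is an iterated one-variable integral, so
    integrability and linearity have to be re-established at every level; all integrands are
    therefore kept uniformly continuous on the cube, and series are exchanged with integrals only
    through truncations that converge uniformly there. [zsum] is a limit over symmetric boxes, and
    the boxes of [mu] and of [p] do not correspond under mu = m + k delta p; unconditional sums,
    which ignore the exhaustion, carry the regrouping. The Gaussian integral over R^l is never
    formed: only box sums of integrals over unit cells occur, estimated one variable at a time by
    completing the square. This shears the box, so the lower estimate has to hold uniformly for
    bounded shifts. Injectivity of the transform is read off from the isometry, the inner product on
    the distributions being definite, and not from an independence argument for theta functions. *)

Section UnconditionalSums.
Variables (K : numFieldType) (I : choiceType).
Implicit Types (T M : I -> K) (s c : K) (A B : {fset I}).

(** Convergence of the net of finite partial sums. Only the order and the norm of [K] enter, so one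
    definition serves [R] and [R[i]], and no exhaustion of [I] is singled out. *)
Definition hsum T s : Prop := forall e, 0 < e ->
  exists A, forall B, (A `<=` B)%fset -> `|\sum_(i <- B) T i - s| <= e.

Lemma hsum0 : hsum (fun=> 0) 0.
Proof.
by move=> e e0; exists fset0 => B _; rewrite big1// subrr normr0 ltW.
Qed.

Lemma hsumD T1 T2 s1 s2 : hsum T1 s1 -> hsum T2 s2 ->
  hsum (fun i => T1 i + T2 i) (s1 + s2).
Proof.
move=> h1 h2 e e0; have e20 : 0 < e / 2 by rewrite divr_gt0.
have [A1 hA1] := h1 _ e20; have [A2 hA2] := h2 _ e20.
exists (A1 `|` A2)%fset => B AB; rewrite big_split/= opprD addrACA.
rewrite (le_trans (ler_normD _ _))// [e]splitr lerD//.
  by apply: hA1; rewrite (fsubset_trans (fsubsetUl _ _) AB).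
by apply: hA2; rewrite (fsubset_trans (fsubsetUr _ _) AB).
Qed.

Lemma hsumZ c T s : hsum T s -> hsum (fun i => c * T i) (c * s).
Proof.
move=> h e e0; have c0 : 0 < `|c| + 1 by rewrite ltr_wpDl.
have [A hA] := h _ (divr_gt0 e0 c0); exists A => B AB.
rewrite -mulr_sumr -mulrBr normrM (le_trans (ler_wpM2l (normr_ge0 _) (hA _ AB)))//.
rewrite mulrCA ler_piMr ?(ltW e0)// ler_pdivrMr// mul1r lerDl.
exact: ler01.
Qed.

Lemma hsum_sum (X : Type) (r : seq X) (P : pred X) (T : X -> I -> K) (s : X -> K) :
  (forall x, P x -> hsum (T x) (s x)) ->
  hsum (fun i => \sum_(x <- r | P x) T x i) (\sum_(x <- r | P x) s x).
Proof.
move=> h; elim: r => [|x r IH].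
  under [X in hsum X]eq_fun do rewrite big_nil.
  by rewrite big_nil; exact: hsum0.
under [X in hsum X]eq_fun do rewrite big_cons.
by rewrite big_cons; case: ifP => // Px; apply: hsumD => //; exact: h.
Qed.

Lemma big_fset_setD (F : I -> K) A B : (A `<=` B)%fset ->
  \sum_(i <- B) F i = \sum_(i <- A) F i + \sum_(i <- (B `\` A)%fset) F i.
Proof.
move=> /fsubsetP AB; rewrite (big_fsetID _ (mem A))/=; congr (_ + _); apply: eq_fbigl => x.
  by rewrite !inE /=; case xA : (x \in A); rewrite ?andbT ?andbF ?AB.
by rewrite !inE /= andbC.
Qed.

(** A Weierstrass estimate: outside [B] the terms of [T] are dominated by those of [M], which total
    at most [S] minus what [B] already takes. The right-hand side does not involve [T], hence
    uniformity over all families with majorant [M]. *)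
Lemma hsum_tail T M s S B : hsum T s -> (forall A, \sum_(i <- A) M i <= S) ->
  (forall i, `|T i| <= M i) ->
  `|\sum_(i <- B) T i - s| <= S - \sum_(i <- B) M i.
Proof.
move=> hT hM TM; apply/ler_addgt0Pr => e e0.
have [A hA] := hT _ e0.
have /hA := fsubsetUr B A; have sBA := fsubsetUl B A.
have := hM (B `|` A)%fset.
rewrite !(big_fset_setD _ sBA); set a := \sum_(i <- B) T i; set b := \sum_(i <- _) T i.
set m := \sum_(i <- B) M i; set n := \sum_(i <- _) M i => hm ha.
have bn : `|b| <= n.
  by rewrite (le_trans (ler_norm_sum _ _ _))// ler_sum.
have -> : a - s = (a + b - s) - b by rewrite addrAC addrK.
rewrite (le_trans (ler_normB _ _))// addrC lerD// (le_trans bn)//.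
by rewrite lerBrDl.
Qed.

End UnconditionalSums.

(** * Change of index in unconditional sums *)

Section Reindexing.
Variables (K : numFieldType) (I J : choiceType) (h : J -> I) (g : I -> J).
Implicit Types (T : I -> K) (s : K) (A B : {fset I}).
Hypothesis hK : cancel h g.

(** The filter [h (g x) == x] tests membership in the range of [h], where [g] inverts [h]. *)
Let preim B : {fset J} := [fset g x | x in [fset x in B | h (g x) == x]]%fset.

Let mem_preim B j : (j \in preim B) = (h j \in B).
Proof.
apply/imfsetP/idP => /=.
  by move=> [x]; rewrite !inE /= => /andP[xB /eqP hx] ->; rewrite hx.
by move=> jB; exists (h j); rewrite ?hK// !inE jB hK /=.
Qed.

Let sum_preim T B : (forall x, h (g x) != x -> T x = 0) ->
  \sum_(x <- B) T x = \sum_(j <- preim B) T (h j).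
Proof.
move=> T0; rewrite /preim big_imfset/=; last first.
  move=> x y; rewrite !inE /= => /andP[_ /eqP hx] /andP[_ /eqP hy] gxy.
  by rewrite -hx -hy gxy.
rewrite (big_fsetID _ [pred x | h (g x) == x])/= addrC [X in X + _](_ : _ = 0) ?add0r; last first.
  by rewrite big_seq big1// => x; rewrite !inE /= => /andP[_]; exact: T0.
rewrite big_seq [RHS]big_seq; apply: eq_bigr => x.
by rewrite !inE /= => /andP[_ /eqP ->].
Qed.

(** The hypothesis confines the support of [T] to the range of [h], so a finite sum over [I] equals
    the sum over the preimage of its index set. *)
Lemma hsum_reindex T s : (forall x, h (g x) != x -> T x = 0) ->
  hsum T s -> hsum (T \o h) s.
Proof.
move=> T0 hT e e0; have [A hA] := hT _ e0.
(* [B] contains the preimage of [A], so enlarging [A] by the image of [B] gives a set whose preimage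
   is exactly [B]. *)
exists (preim A) => B AB; have {hA} := hA (A `|` [fset h j | j in B])%fset (fsubsetUl _ _).
rewrite (sum_preim _ T0) (_ : preim _ = B)//.
apply/fsetP => j; rewrite mem_preim !inE /= mem_imfset; last exact: can_inj hK.
case jB : (j \in B); first by rewrite orbT.
rewrite orbF; apply/negbTE; apply: contraFN jB => jA.
by rewrite (fsubsetP AB)// mem_preim.
Qed.

Lemma hsum_reindexV T s : (forall x, h (g x) != x -> T x = 0) ->
  hsum (T \o h) s -> hsum T s.
Proof.
move=> T0 hT e e0; have [A hA] := hT _ e0.
exists [fset h j | j in A]%fset => B /fsubsetP AB.
rewrite (sum_preim _ T0); apply: hA; apply/fsubsetP => j jA.
by rewrite mem_preim AB// in_imfset.
Qed.

End Reindexing.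

(** * Absolutely convergent real and complex families *)

Section RealSums.
Variables (R : realType) (I : choiceType).
Implicit Types (T : I -> R).

Lemma hsum_nneg_bounded T b : (forall i, 0 <= T i) ->
  (forall B : {fset I}, \sum_(i <- B) T i <= b) ->
  exists2 s, hsum T s & forall B : {fset I}, \sum_(i <- B) T i <= s.
Proof.
move=> T0 Tb.
pose E := [set x | exists B : {fset I}, x = \sum_(i <- B) T i].
have hE : has_sup E.
  split; first by exists (\sum_(i <- fset0) T i), fset0.
  by exists b => x [B ->].
exists (sup E); last first.
  by move=> B; apply: ub_le_sup; [case: hE|exists B].
move=> e e0; have [x [A ->] hA] := sup_adherent e0 hE.
exists A => B AB.
have hB : \sum_(i <- B) T i <= sup E by apply: ub_le_sup; [case: hE|exists B].
rewrite ler0_norm ?subr_le0// opprB lerBlDr -lerBlDl (le_trans (ltW hA))//.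
by rewrite (big_fset_setD _ AB) lerDl sumr_ge0.
Qed.

Lemma hsum_bounded T b :
  (forall B : {fset I}, \sum_(i <- B) `|T i| <= b) -> exists s, hsum T s.
Proof.
move=> Tb.
(* [T] is the difference of the two nonnegative families [|T| + T] and [|T|], both with bounded
   partial sums. *)
have [i|B|s hs _] := @hsum_nneg_bounded (fun i => `|T i| + T i) (b + b).
- by rewrite -lerBlDr sub0r -normrN ler_norm.
- by rewrite big_split/= lerD// (le_trans _ (Tb B))// ler_sum// => i _; rewrite ler_norm.
have [i|//|t ht _] := @hsum_nneg_bounded (fun i => `|T i|) b; first exact: normr_ge0.
exists (s + (- 1) * t).
rewrite (_ : T = fun i => (`|T i| + T i) + (- 1) * `|T i|); last first.
  by apply/funext => i; rewrite mulN1r addrAC subrr add0r.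
by apply: hsumD => //; exact: hsumZ.
Qed.

Lemma hsum_realC T s : hsum T s -> hsum (fun i => (T i)%:C) (s%:C).
Proof.
move=> hT e; rewrite ltcE /= => /andP[/eqP e0 e1].
have [A hA] := hT _ e1; exists A => B /hA.
rewrite -lecR (_ : (complex.Re e)%:C = e); last first.
  by case: e e0 {e1 hA} => a c /= ->.
by apply: le_trans; rewrite -rmorph_sum -rmorphB /= normc_def /= expr0n addr0 sqrtr_sqr.
Qed.

Lemma norm_Im_le (z : R[i]) : `|complex.Im z|%:C <= `|z|.
Proof.
have := normc_ge_Re (z * 'i%C); rewrite ReiNIm normrN normrM.
by rewrite (_ : `|'i%C| = 1 :> R[i]) ?mulr1// normc_def /= expr0n add0r expr1n sqrtr1.
Qed.

Lemma hsumC_bounded (T : I -> R[i]) (b : R) :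
  (forall B : {fset I}, \sum_(i <- B) `|T i| <= b%:C) -> exists s, hsum T s.
Proof.
move=> Tb.
have bd (f : R[i] -> R) : (forall z, `|f z|%:C <= `|z|) ->
    forall B : {fset I}, \sum_(i <- B) `|f (T i)| <= b.
  move=> hf B; rewrite -lecR (le_trans _ (Tb B))// rmorph_sum ler_sum//= => i _.
have [s1 h1] := @hsum_bounded (fun i => complex.Re (T i)) b (bd _ (@normc_ge_Re R)).
have [s2 h2] := @hsum_bounded (fun i => complex.Im (T i)) b (bd _ norm_Im_le).
exists (s1%:C + 'i%C * s2%:C).
rewrite (_ : T = fun i => (complex.Re (T i))%:C + 'i%C * (complex.Im (T i))%:C); last first.
  by apply/funext => i; rewrite -complexE.
by apply: hsumD; [|apply: hsumZ]; exact: hsum_realC.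
Qed.

End RealSums.

(** * Sums over Z^l along boxes, and the geometric majorant *)

Section BoxSums.
Variables (R : realType) (l : nat).
Local Notation Zl := ('I_l -> int).
Implicit Types (mu : Zl) (N : nat).

Definition boxset N : {fset Zl} :=
  [fset ((fun i => (q i)%:Z - N%:Z) : Zl) | q : {ffun 'I_l -> 'I_(2 * N + 1)} in predT]%fset.

Lemma big_boxset (V : nmodType) N (F : Zl -> V) :
  \sum_(mu <- boxset N) F mu =
  \sum_(q : {ffun 'I_l -> 'I_(2 * N + 1)}) F (fun i => (q i)%:Z - N%:Z).
Proof.
rewrite /boxset big_imfset/=; last first.
  move=> p q _ _ pq; apply/ffunP => i; apply/val_inj.
  have := congr1 (fun f => f i) pq => /addIr; by case.
by rewrite big_enum.
Qed.

Lemma boxsumE N (F : Zl -> R[i]) : boxsum N F = \sum_(mu <- boxset N) F mu.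
Proof. by rewrite big_boxset. Qed.

Lemma mem_boxset N mu : (mu \in boxset N) = [forall i, `|mu i| <= N%:Z].
Proof.
apply/imfsetP/forallP => /= [[q _ ->] i|H].
  have := ltn_ord (q i); rewrite ler_norml; lia.
have b i : (absz (mu i + N%:Z)%R < 2 * N + 1)%N.
  by have := H i; rewrite ler_norml; lia.
exists [ffun i => Ordinal (b i)] => //; apply/funext => i.
by rewrite ffunE /=; have := H i; rewrite ler_norml; lia.
Qed.

Lemma boxset_sub m n : (m <= n)%N -> (boxset m `<=` boxset n)%fset.
Proof.
move=> mn; apply/fsubsetP => mu; rewrite !mem_boxset => /forallP H.
by apply/forallP => i; rewrite (le_trans (H i))// lez_nat.
Qed.

Lemma fset_sub_boxset (A : {fset Zl}) :
  exists N0, forall N, (N0 <= N)%N -> (A `<=` boxset N)%fset.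
Proof.
suff [N0 hN0] : exists N0, (A `<=` boxset N0)%fset.
  by exists N0 => N NN0; rewrite (fsubset_trans hN0)// boxset_sub.
exists (\max_(mu <- A) \max_(i < l) `|mu i|%N)%N; apply/fsubsetP => mu muA.
rewrite mem_boxset; apply/forallP => i.
rewrite -abszE lez_nat (@leq_trans (\max_(i < l) `|mu i|)%N)//.
  exact: (@leq_bigmax (Finite.clone _ (ordinal l)) (fun j : ordinal l => absz (mu j)) i).
by rewrite (big_fsetD1 mu muA)/= leq_maxl.
Qed.

Lemma hsum_boxset (K : numFieldType) (T : Zl -> K) s : hsum T s ->
  forall e, 0 < e -> exists N0, forall N, (N0 <= N)%N ->
    `|\sum_(mu <- boxset N) T mu - s| <= e.
Proof.
move=> hT e e0; have [A hA] := hT _ e0; have [N0 hN0] := fset_sub_boxset A.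
by exists N0 => N /hN0 /hA.
Qed.

(** Every finite set lies in a box, so the net of finite sums and the sequence of box sums have the
    same limit. *)
Lemma zsumE (T : Zl -> R[i]) s : hsum T s -> zsum T = s.
Proof.
move=> /hsum_boxset hT; rewrite /zsum; apply: (cvg_lim (@norm_hausdorff _ (R[i])^o)).
apply/cvgrPdist_le => e e0; have [N0 hN0] := hT _ e0.
near=> N; rewrite distrC boxsumE; apply: hN0.
by near: N; exists N0.
Unshelve. all: by end_near.
Qed.

(** Partial sums of nonnegative terms increase, so boxes alone decide. The Gaussian masses of a
    class are known only on boxes and become summable this way. *)
Lemma hsum_nneg_boxset (T : Zl -> R) s : (forall mu, 0 <= T mu) ->
  (forall N, \sum_(mu <- boxset N) T mu <= s) ->
  (forall e, 0 < e -> exists N, s - e <= \sum_(mu <- boxset N) T mu) ->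
  hsum T s.
Proof.
move=> T0 Ts hT e e0; have [N hN] := hT _ e0.
exists (boxset N) => B BN.
have Bs : \sum_(i <- B) T i <= s.
  have [M /(_ _ (leqnn M)) BM] := fset_sub_boxset B.
  by rewrite (le_trans _ (Ts M))// (big_fset_setD _ BM) lerDl sumr_ge0.
rewrite ler0_norm ?subr_le0// opprB lerBlDl -lerBlDr (le_trans hN)//.
by rewrite (big_fset_setD _ BN) lerDl sumr_ge0.
Qed.

(** The common majorant of all theta series: a product of two-sided geometric weights. *)
Definition geomw mu : R := \prod_(i < l) (2^-1) ^+ `|mu i|%N.

Lemma geomw_ge0 mu : 0 <= geomw mu.
Proof. by apply: prodr_ge0 => i _; rewrite exprn_ge0// invr_ge0. Qed.

Lemma sum_geomw_le (A : {fset Zl}) : \sum_(mu <- A) geomw mu <= 3 ^+ l.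
Proof.
have [N /(_ _ (leqnn N)) AN] := fset_sub_boxset A.
apply: (@le_trans _ _ (\sum_(mu <- boxset N) geomw mu)).
  by rewrite (big_fset_setD _ AN) lerDl sumr_ge0// => mu _; exact: geomw_ge0.
rewrite big_boxset /geomw.
rewrite -(bigA_distr_bigA (fun (i : 'I_l) (j : 'I_(2 * N + 1)) => 2^-1 ^+ `|j%:Z - N%:Z|%N)).
rewrite -[l in leRHS]card_ord -prodr_const ler_prod// => i _.
rewrite sumr_ge0 => [|j _]; last by rewrite exprn_ge0// invr_ge0.
(* Closed form of 1 + 2 (1/2 + ... + 2^-N); the induction adds the two outermost terms. *)
rewrite /=; suff -> : \sum_(j < 2 * N + 1) 2^-1 ^+ `|j%:Z - N%:Z|%N = 3 - 2 * 2^-1 ^+ N :> R.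
  by rewrite gerBl mulr_ge0// exprn_ge0// invr_ge0.
elim: N {AN} => [|N IH].
  by rewrite big_ord1 subrr expr0; lra.
rewrite (_ : 2 * N.+1 + 1 = (2 * N + 1).+2)%N; last by lia.
rewrite big_ord_recl big_ord_recr /= -{1}(_ : 2^-1 ^+ N.+1 = 2^-1 ^+ `|0%:Z - N.+1%:Z|%N); last first.
  by congr (_ ^+ _); lia.
rewrite (_ : `|_ - _|%N = N.+1); last by rewrite /bump/=; lia.
under eq_bigr => j _.
  rewrite (_ : `|_ - _|%N = `|j%:Z - N%:Z|%N); last by rewrite /bump/=; lia.
  over.
by rewrite IH exprS; lra.
Qed.

Lemma hsumC_geomw (T : Zl -> R[i]) (c : R) :
  (forall mu, `|T mu| <= (c * geomw mu)%:C) -> exists s, hsum T s.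
Proof.
move=> Tc; case: (leP 0 c) => c0.
  apply: (@hsumC_bounded _ _ _ (c * 3 ^+ l)) => B.
  rewrite (@le_trans _ _ (\sum_(i <- B) (c * geomw i)%:C)) ?ler_sum//.
  by rewrite -rmorph_sum -mulr_sumr lecR ler_wpM2l// sum_geomw_le.
(* A negative [c] forces every term to vanish. *)
apply: (@hsumC_bounded _ _ _ 0) => B.
rewrite big1// => mu _; apply/eqP; rewrite eq_le normr_ge0 andbT.
by rewrite (le_trans (Tc mu))// lecR mulr_le0_ge0 ?geomw_ge0// ltW.
Qed.

(** Weierstrass test: [N0] is chosen from the majorant alone and therefore serves every [x] in
    [D]. *)
Lemma hsum_geomw_unif (X : Type) (D : X -> Prop) (T : X -> Zl -> R[i]) (s : X -> R[i]) (c : R) :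
  (forall x, D x -> hsum (T x) (s x)) ->
  (forall x mu, D x -> `|T x mu| <= (c * geomw mu)%:C) ->
  forall e : R, 0 < e -> exists N0, forall N, (N0 <= N)%N -> forall x, D x ->
    `|\sum_(mu <- boxset N) T x mu - s x| <= e%:C.
Proof.
move=> hT Tc e e0.
wlog c0 : c Tc / 0 <= c.
  move=> /(_ `|c|); apply => // x mu Dx; rewrite (le_trans (Tc x mu Dx))//.
  by rewrite lecR ler_wpM2r ?geomw_ge0// ler_norm.
have [mu|B|S hS hSB] := @hsum_nneg_bounded R Zl (fun mu => c * geomw mu) (c * 3 ^+ l).
- by rewrite mulr_ge0// geomw_ge0.
- by rewrite -mulr_sumr ler_wpM2l// sum_geomw_le.
have [N0 hN0] := hsum_boxset hS e0.
exists N0 => N NN0 x Dx.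
apply: le_trans (hsum_tail (M := fun mu => (c * geomw mu)%:C) (S := S%:C) _ (hT _ Dx) _ _) _.
- by move=> A; rewrite -rmorph_sum lecR.
- by move=> mu; exact: Tc.
- rewrite -rmorph_sum -rmorphB lecR (le_trans _ (hN0 _ NN0))//.
  by rewrite -normrN opprB ler_norm.
Qed.

End BoxSums.

(** * Iterated integrals over the unit cube *)

Section UniformlyContinuousOnBoxes.
Variable R : realType.
Implicit Types (F G : seq R -> R) (n : nat) (s t : seq R).

(* Points of [0,1]^n are lists, as in [boxint]; in [UC] the index [i] may run
   past the end, where both entries read 0. *)
Definition inbox n s := (size s == n) && all (fun x => 0 <= x <= 1) s.

Lemma inbox_cons n x s : inbox n.+1 (x :: s) = (0 <= x <= 1) && inbox n s.
Proof. by rewrite /inbox /= eqSS andbCA. Qed.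

Lemma inbox_nth n s i : inbox n s -> 0 <= s`_i <= 1.
Proof.
move=> /andP[_ /all_nthP H]; have [si|si] := ltnP i (size s); first exact: H.
by rewrite nth_default// lexx ler01.
Qed.

(** Uniform continuity for the sup distance. One modulus serves all slices [x :: s], so the inner
    integral is again uniformly continuous in [x]; this drives the induction on the number of
    variables. *)
Definition UC n F := forall e, 0 < e -> exists2 d, 0 < d & forall s t,
  inbox n s -> inbox n t -> (forall i, `|s`_i - t`_i| <= d) -> `|F s - F t| <= e.

Lemma UC_cst n c : UC n (fun=> c).
Proof. by move=> e e0; exists 1 => // s t _ _ _; rewrite subrr normr0 ltW. Qed.

Lemma UC_nth n i : UC n (fun s => s`_i).
Proof. by move=> e e0; exists e => // s t _ _; exact. Qed.

Lemma UC_eq n F G : (forall s, inbox n s -> F s = G s) -> UC n F -> UC n G.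
Proof.
move=> FG hF e e0; have [d d0 hd] := hF e e0; exists d => // s t sb tb st.
by rewrite -!FG//; exact: hd.
Qed.

Lemma UCD n F G : UC n F -> UC n G -> UC n (fun s => F s + G s).
Proof.
move=> hF hG e e0; have e20 : 0 < e / 2 by rewrite divr_gt0.
have [d1 d10 h1] := hF _ e20; have [d2 d20 h2] := hG _ e20.
exists (Num.min d1 d2); first by rewrite lt_min d10.
move=> s t sb tb st; rewrite opprD addrACA (le_trans (ler_normD _ _))// [e]splitr.
rewrite lerD// ?h1 ?h2// => i; apply: (le_trans (st i)); last by rewrite ge_min lexx orbT.
by rewrite ge_min lexx.
Qed.

Lemma UC_limit n F : (forall e, 0 < e -> exists2 G, UC n G &
    forall s, inbox n s -> `|F s - G s| <= e) -> UC n F.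
Proof.
move=> H e e0; have e30 : 0 < e / 3 by rewrite divr_gt0.
have [G hG FG] := H _ e30; have [d d0 hd] := hG _ e30.
exists d => // s t sb tb st.
have -> : F s - F t = (F s - G s) + (G s - G t) - (F t - G t) by ring.
rewrite (le_trans (ler_normB _ _))// (le_trans (lerD (ler_normD _ _) (lexx _)))//.
have := FG _ sb; have := FG _ tb; have := hd _ _ sb tb st; lra.
Qed.

(** [g] is Lipschitz on bounded intervals only, as [expR] is; boundedness of [F] keeps its values in
    one of them. *)
Lemma UC_comp n F (g : R -> R) :
  (forall M, exists2 K, 0 < K & forall x y, `|x| <= M -> `|y| <= M ->
    `|g x - g y| <= K * `|x - y|) ->
  (exists M, forall s, inbox n s -> `|F s| <= M) ->
  UC n F -> UC n (g \o F).
Proof.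
move=> hg [M FM] hF e e0; have [K K0 hK] := hg M.
have [d d0 hd] := hF _ (divr_gt0 e0 K0); exists d => // s t sb tb st.
rewrite /= (le_trans (hK _ _ (FM _ sb) (FM _ tb)))// mulrC -ler_pdivlMr//.
exact: hd.
Qed.

(* Walk from s to t in finitely many steps shorter than the modulus of continuity. *)
Lemma UC_bounded n F : UC n F -> exists M, forall s, inbox n s -> `|F s| <= M.
Proof.
move=> /(_ 1 ltr01)[d d0 hd].
pose N := (Num.truncn d^-1).+1.
have Nd : N%:R^-1 <= d by rewrite -[d]invrK lef_pV2 ?posrE ?invr_gt0// ltW// truncnS_gt.
exists (`|F (nseq n 0)| + N%:R) => s sb.
pose p j := [seq x * (j%:R / N%:R) | x <- s].
have pb j : (j <= N)%N -> inbox n (p j).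
  move=> jN; move: sb => /andP[/eqP ss /allP sb].
  rewrite /inbox size_map ss eqxx; apply/allP => _ /mapP[x /sb /andP[x0 x1] ->].
  rewrite mulr_ge0 ?divr_ge0//= mulr_ile1 ?divr_ge0// ler_pdivrMr ?mul1r ?ler_nat//.
have pj j : (j < N)%N -> `|F (p j.+1) - F (p j)| <= 1.
  move=> jN; apply: hd; [exact: pb|by apply: pb; exact: ltnW|move=> i].
  have [si|si] := ltnP i (size s); last first.
    by rewrite !nth_default ?size_map// subrr normr0 ltW.
  rewrite !(nth_map 0)// -mulrBr -mulrBl mulrSr addrAC subrr add0r mul1r.
  have /andP[s0 s1] := inbox_nth i sb.
  rewrite ger0_norm ?mulr_ge0 ?invr_ge0// (le_trans _ Nd)// ler_piMl ?invr_ge0//.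
have H j : (j <= N)%N -> `|F (p j)| <= `|F (nseq n 0)| + j%:R.
  elim: j => [_|j IH jN].
    rewrite (_ : p 0%N = nseq n 0) ?addr0//.
    move: sb => /andP[/eqP <- _]; rewrite /p mul0r; elim: (s) => //= x r ->.
    by rewrite mulr0.
  rewrite -[F _](subrK (F (p j))) (le_trans (ler_normD _ _))// mulrSr addrA addrC.
  by rewrite lerD// ?IH ?pj// ltnW.
have := H N (leqnn _); rewrite (_ : p N = s)//.
by rewrite /p divff ?pnatr_eq0//; elim: (s) => //= x r {1}->; rewrite mulr1.
Qed.

Lemma UCM n F G : UC n F -> UC n G -> UC n (fun s => F s * G s).
Proof.
move=> hF hG; have [M FM] := UC_bounded hF; have [M' GM] := UC_bounded hG.
pose K := `|M| + `|M'| + 1.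
have K0 : 0 < K by rewrite ltr_wpDl// addr_ge0.
have {}FM s : inbox n s -> `|F s| <= K.
  by move=> /FM; have := ler_norm M; have := normr_ge0 M'; rewrite /K; lra.
have {}GM s : inbox n s -> `|G s| <= K.
  by move=> /GM; have := ler_norm M'; have := normr_ge0 M; rewrite /K; lra.
move=> e e0; have e20 : 0 < e / (2 * K) by rewrite divr_gt0// mulr_gt0.
have [d1 d10 h1] := hF _ e20; have [d2 d20 h2] := hG _ e20.
exists (Num.min d1 d2); first by rewrite lt_min d10.
move=> s t sb tb st.
have -> : F s * G s - F t * G t = F s * (G s - G t) + (F s - F t) * G t by ring.
have -> : e = K * (e / (2 * K)) + e / (2 * K) * K by field; rewrite gt_eqF.
rewrite (le_trans (ler_normD _ _))// !normrM lerD// ler_pM// ?FM ?GM// ?h1 ?h2// => i.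
  by apply: (le_trans (st i)); by rewrite ge_min lexx orbT.
by apply: (le_trans (st i)); rewrite ge_min lexx.
Qed.

Lemma UCN n F : UC n F -> UC n (fun s => - F s).
Proof.
by move=> hF; apply: UC_eq (UCM (UC_cst n (-1)) hF) => s _; rewrite mulN1r.
Qed.

Lemma UC_sum n (I : Type) (r : seq I) (P : pred I) (F : I -> seq R -> R) :
  (forall i, P i -> UC n (F i)) -> UC n (fun s => \sum_(i <- r | P i) F i s).
Proof.
move=> hF; elim: r => [|i r IH].
  by apply: UC_eq (UC_cst n 0) => s _; rewrite big_nil.
case: (boolP (P i)) => Pi.
  by apply: UC_eq (UCD (hF _ Pi) IH) => s _; rewrite big_cons Pi.
by apply: UC_eq IH => s _; rewrite big_cons (negbTE Pi).
Qed.

Lemma UC_expR n F : UC n F -> UC n (fun s => expR (F s)).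
Proof.
move=> hF; apply: (UC_comp (g := expR)) (UC_bounded hF) hF => M.
exists (expR M); first exact: expR_gt0.
move=> x y; wlog xy : x y / x <= y => [W xM yM|xM yM].
  have [xy|/ltW yx] := leP x y; first exact: W.
  by rewrite distrC [X in _ <= _ * X]distrC; exact: W.
rewrite distrC [X in _ <= _ * X]distrC !ger0_norm ?subr_ge0 ?ler_expR//.
(* The Lipschitz constant comes from [1 + u <= expR u] at [u = x - y], together with
   [expR y <= expR M]. *)
have -> : expR y - expR x = expR y * (1 - expR (x - y)).
  by rewrite mulrBr mulr1 -expRD [y + _]addrC subrK.
rewrite (@le_trans _ _ (expR y * (y - x)))// ?ler_wpM2l ?expR_ge0//.
  by have := expR_ge1Dx (x - y); lra.
by rewrite ler_wpM2r ?subr_ge0// ler_expR (le_trans _ yM)// ler_norm.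
Qed.

Lemma UC_trig n F (f df : R -> R) : (forall x : R, is_derive x 1 f (df x)) ->
  continuous f -> (forall x, `|df x| <= 1) -> UC n F -> UC n (fun s => f (F s)).
Proof.
move=> hf cf df1 hF; apply: (UC_comp (g := f)) (UC_bounded hF) hF => M.
exists 1 => // x y _ _; rewrite mul1r.
wlog xy : x y / x <= y => [W|].
  have [xy|/ltW yx] := leP x y; first exact: W.
  by rewrite distrC [leRHS]distrC; exact: W.
rewrite distrC [leRHS]distrC.
have [c _ ->] := MVT_segment xy (fun x _ => hf x) (continuous_subspaceT cf).
by rewrite normrM ler_piMl.
Qed.

Lemma UC_cos n F : UC n F -> UC n (fun s => cos (F s)).
Proof.
apply: (UC_trig (df := fun x => - sin x)).
- exact: continuous_cos.
- by move=> x; rewrite normrN sin_max.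
Qed.

Lemma UC_sin n F : UC n F -> UC n (fun s => sin (F s)).
Proof.
apply: (UC_trig (df := cos)).
- exact: continuous_sin.
- exact: cos_max.
Qed.

Lemma UC_cons n F x : 0 <= x <= 1 -> UC n.+1 F -> UC n (fun s => F (x :: s)).
Proof.
move=> x01 hF e e0; have [d d0 hd] := hF e e0; exists d => // s t sb tb st.
apply: hd; rewrite ?inbox_cons ?x01// => -[|i] /=; last exact: st.
by rewrite subrr normr0 ltW.
Qed.

End UniformlyContinuousOnBoxes.

(** * Linearity and monotonicity of the iterated integral *)

Section BoxIntegral.
Variable R : realType.
Implicit Types (F G : seq R -> R) (n : nat) (s t : seq R).
Local Notation mu := (@lebesgue_measure R).
Local Notation I01 := (`[0%R, 1%R]%classic : set R).

Lemma eq_boxint n F G : (forall s, inbox n s -> F s = G s) -> boxint n F = boxint n G.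
Proof.
elim: n F G => [|n IH] F G FG /=; first exact: FG.
apply: eq_Rintegral => x /set_mem; rewrite /= in_itv /= => x01.
by apply: IH => s sb; apply: FG; rewrite inbox_cons x01.
Qed.

Lemma boxint_ge0 n F : (forall s, inbox n s -> 0 <= F s) -> 0 <= boxint n F.
Proof.
elim: n F => [|n IH] F F0 /=; first exact: F0.
apply: Rintegral_ge0 => x; rewrite /= in_itv /= => x01.
by apply: IH => s sb; apply: F0; rewrite inbox_cons x01.
Qed.

Lemma boxint_cst n (c : R) : boxint n (fun=> c) = c.
Proof.
elim: n => //= n ->; rewrite Rintegral_cst//= lebesgue_measure_itv /= lte_fin ltr01.
by rewrite oppr0 adde0 /= mulr1.
Qed.

Lemma integrable_I01 (f : R -> R) :
  (forall e, 0 < e -> exists2 d, 0 < d & forall x y, 0 <= x <= 1 -> 0 <= y <= 1 ->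
    `|x - y| <= d -> `|f x - f y| <= e) ->
  mu.-integrable I01 (EFin \o f).
Proof.
move=> hf; apply: continuous_compact_integrable; first exact: segment_compact.
apply/subspace_continuousP => x; rewrite /= in_itv /= => x01.
apply/cvgrPdist_le => e e0; have [d d0 hd] := hf e e0.
rewrite near_withinE; near=> y; rewrite /= in_itv /= => y01.
by apply: hd => //; near: y; exact: cvgr_dist_le.
Unshelve. all: by end_near.
Qed.

(** The two claims feed each other: linearity in dimension n yields monotonicity, hence continuity
    of the inner integral in the outer variable, hence its integrability, and this is what linearity
    in dimension n + 1 requires. *)
Lemma boxint_linear n :
  (forall F G c, UC n F -> UC n G ->
     boxint n (fun s => c * F s + G s) = c * boxint n F + boxint n G) /\
  (forall F, UC n.+1 F -> mu.-integrable I01 (EFin \o (fun x => boxint n (fun s => F (x :: s))))).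
Proof.
have step m : (forall F G c, UC m F -> UC m G ->
     boxint m (fun s => c * F s + G s) = c * boxint m F + boxint m G) ->
  (forall F, UC m.+1 F -> mu.-integrable I01 (EFin \o (fun x => boxint m (fun s => F (x :: s))))).
  move=> lin F hF; apply: integrable_I01 => e e0.
  have [d d0 hd] := hF e e0; exists d => // x y x01 y01 xy.
  have hx := UC_cons x01 hF; have hy := UC_cons y01 hF.
  (* Monotonicity is positivity of the integral of the difference, split by [lin] with scalar -1. *)
  have mono G1 G2 : UC m G1 -> UC m G2 -> (forall s, inbox m s -> G1 s <= G2 s) ->
      boxint m G1 <= boxint m G2.
    move=> h1 h2 H; rewrite -subr_ge0 -mulN1r addrC -lin//.
    by apply: boxint_ge0 => s sb; rewrite mulN1r addrC subr_ge0 H.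
  have close s : inbox m s -> `|F (x :: s) - F (y :: s)| <= e.
    move=> sb; apply: hd; rewrite ?inbox_cons ?x01 ?y01// => -[//|i].
    by rewrite subrr normr0 ltW.
  have add G : UC m G -> boxint m (fun s => 1 * G s + e) = boxint m G + e.
    by move=> hG; rewrite lin ?mul1r ?boxint_cst//; exact: UC_cst.
  have h1 z : 0 <= z <= 1 -> UC m (fun s => 1 * F (z :: s) + e).
    move=> z01; apply: UCD; last exact: UC_cst.
    by apply: UCM; [exact: UC_cst|exact: UC_cons].
  have A : boxint m (fun s => F (x :: s)) <= boxint m (fun s => F (y :: s)) + e.
    rewrite -add//; apply: mono => //; first exact: h1.
    by move=> s /close; rewrite ler_norml mul1r; lra.
  have B : boxint m (fun s => F (y :: s)) <= boxint m (fun s => F (x :: s)) + e.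
    rewrite -add//; apply: mono => //; first exact: h1.
    by move=> s /close; rewrite ler_norml mul1r; lra.
  by rewrite ler_norml; move: A B; lra.
suff lin : forall F G c, UC n F -> UC n G ->
     boxint n (fun s => c * F s + G s) = c * boxint n F + boxint n G.
  by split=> //; exact: step.
elim: n => [//|n IH] F G c hF hG /=.
have iF := step n IH _ hF; have iG := step n IH _ hG.
rewrite -RintegralZl// -RintegralD//; last by apply: (@integrableZl _ _ R mu _ _ c _ iF).
apply: eq_Rintegral => x /set_mem; rewrite /= in_itv /= => x01.
by rewrite IH//; exact: UC_cons.
Qed.

Lemma boxintD n F G : UC n F -> UC n G ->
  boxint n (fun s => F s + G s) = boxint n F + boxint n G.
Proof.
move=> hF hG; have := (boxint_linear n).1 F G 1 hF hG; rewrite mul1r => <-.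
by apply: eq_boxint => s _; rewrite mul1r.
Qed.

Lemma boxintZ n c F : UC n F -> boxint n (fun s => c * F s) = c * boxint n F.
Proof.
move=> hF; rewrite -[RHS]addr0 -(boxint_cst n 0) -(boxint_linear n).1//; last exact: UC_cst.
by apply: eq_boxint => s _; rewrite addr0.
Qed.

Lemma boxintB n F G : UC n F -> UC n G ->
  boxint n (fun s => F s - G s) = boxint n F - boxint n G.
Proof.
move=> hF hG; rewrite boxintD//; last exact: UCN.
rewrite -[- boxint n G]mulN1r -boxintZ//; congr (_ + _).
by apply: eq_boxint => s _; rewrite mulN1r.
Qed.

Lemma boxint_sum n (I : Type) (r : seq I) (P : pred I) (F : I -> seq R -> R) :
  (forall i, P i -> UC n (F i)) ->
  boxint n (fun s => \sum_(i <- r | P i) F i s) = \sum_(i <- r | P i) boxint n (F i).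
Proof.
move=> hF; elim: r => [|i r IH].
  by rewrite big_nil -[RHS](boxint_cst n); apply: eq_boxint => s _; rewrite big_nil.
rewrite big_cons -IH; case: ifP => Pi.
  rewrite -boxintD; [|exact: hF|exact: UC_sum].
  by apply: eq_boxint => s _; rewrite big_cons Pi.
by apply: eq_boxint => s _; rewrite big_cons Pi.
Qed.

Lemma le_boxint n F G : UC n F -> UC n G -> (forall s, inbox n s -> F s <= G s) ->
  boxint n F <= boxint n G.
Proof.
move=> hF hG FG; rewrite -subr_ge0 -boxintB//.
by apply: boxint_ge0 => s sb; rewrite subr_ge0 FG.
Qed.

Lemma boxint_cat m n F :
  boxint (m + n) F = boxint m (fun s => boxint n (fun t => F (s ++ t))).
Proof. by elim: m F => //= m IH F; apply: eq_Rintegral => x _; rewrite IH. Qed.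

End BoxIntegral.
(** * Gaussian integrals *)

Section GaussianOneDim.
Variable R : realType.
Local Notation mu := (@lebesgue_measure R).
Local Notation I01 := (`[0%R, 1%R]%classic : set R).

(** The identity as a random variable: its [cdf] under a normal law is the Gaussian primitive wanted
    below. *)
Let idTR : measurableTypeR R -> R := idfun.

#[local] HB.instance Definition _ :=
  @isMeasurableFun.Build _ _ _ _ idTR (@measurable_id _ _ setT).

(** [Phi] is sqrt(pi / d) times the distribution function of a centred normal law. The derivative
    comes from the fundamental theorem of calculus, the bounds from a probability lying in [0, 1],
    the behaviour at infinity from the limits of a [cdf]. *)
Lemma gauss_primitive (d : R) : 0 < d -> exists Phi : R -> R,
  [/\ forall x : R, is_derive x 1 Phi (expR (- (d * x ^+ 2))),
      forall x, 0 <= Phi x <= Num.sqrt (pi / d) &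
      forall e, 0 < e -> exists K, forall x, K <= x ->
        Num.sqrt (pi / d) - e <= Phi x /\ Phi (- x) <= e].
Proof.
(* Variance 1 / (2 d) makes the normal density proportional to exp(- d x^2), with factor 1 / sqrt(pi
   / d). *)
move=> d0; pose s : R := (Num.sqrt (2 * d))^-1.
have s0 : s != 0 by rewrite gt_eqF// invr_gt0 sqrtr_gt0 mulr_gt0.
have s2 : s ^+ 2 = (2 * d)^-1 by rewrite exprVn sqr_sqrtr// mulr_ge0// ltW.
have peakE : normal_peak s = (Num.sqrt (pi / d))^-1.
  rewrite /normal_peak; congr ((Num.sqrt _)^-1).
  by rewrite s2 -mulr_natr; field; rewrite gt_eqF.
set c := Num.sqrt (pi / d).
have c0 : 0 < c by rewrite sqrtr_gt0 divr_gt0// pi_gt0.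
have pdfE x : normal_pdf 0 s x = c^-1 * expR (- (d * x ^+ 2)).
  rewrite normal_pdfE// peakE; congr (_ * expR _).
  by rewrite s2 subr0 -mulr_natr; field; rewrite gt_eqF.
pose P := normal_prob (0 : R) s.
pose Phi0 x := \int[mu]_(t in `]-oo, x]) normal_pdf 0 s t.
have cdfE x : fine (cdf (idTR : {RV P >-> R}) x) = Phi0 x.
  rewrite /cdf /distribution /pushforward preimage_id.
  by [].
have Phi01 x : 0 <= Phi0 x <= 1.
  rewrite -cdfE; apply/andP; split; first exact: fine_ge0.
  by rewrite -lee_fin fineK ?fin_num_measure// cdf_le1.
exists (fun x => c * Phi0 x); split.
- move=> x; have [] := @continuous_FTC1 R (normal_pdf 0 s) -oo%O x (x + 1).
  + by rewrite ltrDl.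
  + exact: (integrableS _ _ (@subsetT _ _) (integrable_normal_pdf 0 s)).
  + by rewrite ltNyr.
  + exact: (@continuous_normal_pdf R 0 s s0).
  rewrite -/Phi0 derive1E => dPhi ePhi.
  apply: DeriveDef; first by apply: derivableM.
  rewrite deriveM// derive_cst scaler0 addr0 ePhi pdfE /GRing.scale /= mulrA.
  by rewrite divff ?mul1r// gt_eqF.
- by move=> x; have := Phi01 x; move=> /andP[? ?]; rewrite mulr_ge0 ?(ltW c0)//= ler_piMr// ltW.
- move=> e e0; have ec0 : 0 < e / c by rewrite divr_gt0.
  have hy : Phi0 x @[x --> +oo] --> (1 : R).
    by under eq_fun do rewrite -cdfE; apply/fine_cvg/cvg_cdfy1.
  have hNy : Phi0 x @[x --> -oo] --> (0 : R).
    by under eq_fun do rewrite -cdfE; apply/fine_cvg/cvg_cdfNy0.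
  move/cvgrPdist_le : hy => /(_ _ ec0) [K1 [_ hK1]].
  move/cvgrPdist_le : hNy => /(_ _ ec0) [K2 [_ hK2]].
  (* The offsets by 1 turn [K <= x] into the strict inequalities demanded by the neighbourhoods of
     +oo and -oo. *)
  exists (Num.max (K1 + 1) (1 - K2)) => x; rewrite ge_max => /andP[x1 x2].
  have {}hK1 := hK1 x ltac:(lra); have {}hK2 := hK2 (- x) ltac:(lra).
  rewrite /= in hK1 hK2; split.
    have -> : c - e = c * (1 - e / c) by field; rewrite gt_eqF.
    rewrite ler_wpM2l//; first exact: ltW.
    by move: hK1; rewrite ler_norml; lra.
  rewrite mulrC -ler_pdivlMr//.
  by move: hK2; rewrite ler_norml; lra.
Qed.
End GaussianOneDim.

(** * Gaussian integrals over integer cells of the line *)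

Section GaussianSums.
Variable R : realType.
Local Notation mu := (@lebesgue_measure R).
Local Notation I01 := (`[0%R, 1%R]%classic : set R).

Lemma sum_centered_recr (V : nmodType) N (F : int -> V) :
  \sum_(i < 2 * N.+1 + 1) F (i%:Z - N.+1%:Z) =
  F (- N.+1%:Z) + \sum_(i < 2 * N + 1) F (i%:Z - N%:Z) + F N.+1%:Z.
Proof.
rewrite (_ : 2 * N.+1 + 1 = (2 * N + 1).+2)%N; last by lia.
rewrite big_ord_recl big_ord_recr /= addrA; congr (F _ + _ + F _); rewrite /bump/=; try lia.
by apply: eq_bigr => j _; congr F; rewrite /bump /=; lia.
Qed.

Lemma le_sum_centered M N (F : int -> R) : (forall z, 0 <= F z) -> (M <= N)%N ->
  \sum_(i < 2 * M + 1) F (i%:Z - M%:Z) <= \sum_(i < 2 * N + 1) F (i%:Z - N%:Z).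
Proof.
move=> F0 /subnK <-; elim: (N - M)%N => [|k IH]; first by rewrite add0n.
by rewrite addSn sum_centered_recr (le_trans IH)// -addrA addrCA lerDl addr_ge0.
Qed.

Lemma Rintegral01_FTC (f F : R -> R) : (forall x : R, is_derive x 1 F (f x)) -> continuous f ->
  \int[lebesgue_measure]_(x in `[0%R, 1%R]) f x = F 1 - F 0.
Proof.
move=> dF cf; rewrite /Rintegral (@continuous_FTC2 R f F 0 1 ltr01)//.
- exact: continuous_subspaceT.
- have cF : continuous F.
    by move=> x; apply: differentiable_continuous; apply/derivable1_diffP; have [] := dF x.
  split.
  + by move=> x _; have [] := dF x.
  + exact/cvg_at_right_filter/cF.
  + exact/cvg_at_left_filter/cF.
- by move=> x _; rewrite derive1E; have [_ ->] := dF x.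
Qed.

Lemma gauss_shift (d : R) (Phi : R -> R) b :
  (forall x : R, is_derive x 1 Phi (expR (- (d * x ^+ 2)))) ->
  \int[mu]_(x in I01) expR (- (d * (x + b) ^+ 2)) = Phi (1 + b) - Phi b.
Proof.
move=> dPhi; have dF x : is_derive x (1 : R) (fun x => Phi (x + b)) (expR (- (d * (x + b) ^+ 2))).
  have h : is_derive x (1 : R) (fun x => x + b) (1 + 0) by apply: is_deriveD.
  have := @is_derive1_comp R Phi (fun x => x + b) x _ _ (dPhi (x + b)) h.
  by rewrite addr0 mulr1.
rewrite (Rintegral01_FTC dF) ?add0r// => x.
apply: (@continuous_comp R R R (fun x => - (d * (x + b) ^+ 2)) expR); last exact: continuous_expR.
apply: (@cvgN _ R^o); apply: cvgM; first exact: cvg_cst.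
apply: (@continuous_comp R R R (fun x => x + b) (fun x => x ^+ 2)); last exact: exprn_continuous.
by apply: (@cvgD _ R^o); [exact: cvg_id|exact: cvg_cst].
Qed.

(** The cell integrals telescope to Phi(1 + N + a) - Phi(-N + a). The upper bound holds for every
    shift; the lower one is uniform on bounded shifts, which the induction on the dimension
    needs. *)
Lemma sum_gauss1 (d : R) (c := Num.sqrt (pi / d)) : 0 < d ->
  (forall N a, \sum_(i < 2 * N + 1)
     \int[mu]_(x in I01) expR (- (d * (x + ((i%:Z - N%:Z)%:~R + a)) ^+ 2)) <= c) /\
  (forall e K, 0 < e -> exists N, forall a, `|a| <= K ->
     c - e <= \sum_(i < 2 * N + 1)
     \int[mu]_(x in I01) expR (- (d * (x + ((i%:Z - N%:Z)%:~R + a)) ^+ 2))).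
Proof.
move=> d0; have [Phi [dPhi Phi_bd Phi_lim]] := gauss_primitive d0.
have E N a : \sum_(i < 2 * N + 1)
     \int[mu]_(x in I01) expR (- (d * (x + ((i%:Z - N%:Z)%:~R + a)) ^+ 2)) =
     Phi (1 + (N%:R + a)) - Phi (- N%:R + a).
  under eq_bigr do rewrite (gauss_shift _ dPhi).
  elim: N => [|N IH]; first by rewrite big_ord1 subrr oppr0 !add0r.
  rewrite (sum_centered_recr N (fun z => Phi (1 + (z%:~R + a)) - Phi (z%:~R + a))) IH.
  have -> : 1 + ((- N.+1%:Z)%:~R + a) = - N%:R + a.
    by rewrite mulrNz -pmulrn mulrSr; ring.
  have -> : (N.+1%:Z)%:~R + a = 1 + (N%:R + a) by rewrite -pmulrn mulrSr; ring.
  by rewrite mulrNz -pmulrn; ring.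
split=> [N a|e K e0].
  rewrite E; have /andP[_ h1] := Phi_bd (1 + (N%:R + a)).
  by have /andP[h2 _] := Phi_bd (- N%:R + a); move: h1 h2; rewrite -/c; lra.
have [L hL] := Phi_lim (e / 2) ltac:(lra).
(* With N > |L| + |K|, both endpoints of the tiled interval lie beyond the threshold [L] for every
   admissible shift. *)
exists (Num.truncn (`|L| + `|K|)).+1 => a aK; rewrite E.
set N := _.+1; have hN : `|L| + `|K| < N%:R by exact: truncnS_gt.
have ? := ler_norm L; have ? := ler_norm K; move: aK; rewrite ler_norml => /andP[a1 a2].
have [h1 _] := hL (1 + (N%:R + a)) ltac:(lra).
have [_] := hL (N%:R - a) ltac:(lra).
rewrite opprB [a - _]addrC; move: h1; rewrite -/c; lra.
Qed.

End GaussianSums.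

(** * Quadratic forms and the Schur complement *)

Section QuadraticForms.
Variable R : realType.

Definition qf n (A : 'M[R]_n) (v : 'cV[R]_n) : R := (v^T *m A *m v) 0 0.

Lemma qfE n (A : 'M[R]_n) v : qf A v = \sum_i \sum_j v i 0 * A i j * v j 0.
Proof.
rewrite /qf mxE exchange_big/=; apply: eq_bigr => j _.
by rewrite mxE mulr_suml; apply: eq_bigr => i _; rewrite mxE.
Qed.

Definition posdef n (A : 'M[R]_n) : Prop := forall v, v != 0 -> 0 < qf A v.

Lemma mx11_eq (B C : 'M[R]_1) : B 0 0 = C 0 0 -> B = C.
Proof. by move=> BC; apply/matrixP => i j; rewrite !ord1. Qed.

Section Schur.
Variables (n : nat) (A : 'M[R]_(1 + n)).
Hypothesis Asym : A^T = A.
Let S := drsubmx A.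
Let b := ursubmx A.
(** When [S] is positive definite, x y is the point where [qf A (col_mx x v)] is minimal in v for
    fixed x, and the minimum is d x^2, with [d] the Schur complement of [S] written as a quotient of
    determinants. *)
Let y : 'cV[R]_n := - (invmx S *m b^T).
Let d : R := \det A / \det S.

Lemma schur_blockE : A = block_mx (ulsubmx A) b b^T S.
Proof. by rewrite -[LHS]submxK /b trmx_ursub Asym. Qed.

Lemma schur_sym : S^T = S.
Proof. by rewrite /S trmx_drsub Asym. Qed.

(** [qf S] is [qf A] restricted to vectors with first coordinate 0. *)
Lemma schur_posdef : posdef A -> posdef S.
Proof.
move=> pA v v0.
have -> : qf S v = qf A (col_mx 0 v).
  rewrite /qf schur_blockE tr_col_mx trmx0 mul_row_block !mul0mx !add0r.
  by rewrite mul_row_col mulmx0 add0r.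
by apply: pA; apply: contra v0; rewrite col_mx_eq0 => /andP[].
Qed.

Hypothesis dS : 0 < \det S.

Let Sunit : S \in unitmx.
Proof. by rewrite unitmxE unitfE gt_eqF. Qed.

(** The lower block vanishes by the choice of [y]. The top entry is found by determinants:
    multiplying [A] by a unipotent block matrix makes it block triangular with diagonal blocks that
    entry and [S]. *)
Let Au : A *m col_mx 1%:M y = col_mx d%:M 0.
Proof.
have Ay : A *m col_mx 1%:M y = col_mx (ulsubmx A + b *m y) 0.
  rewrite {1}schur_blockE mul_block_col !mulmx1; congr col_mx.
  by rewrite /y mulmxN mulKVmx// subrr.
rewrite Ay; congr col_mx.
have : \det (A *m block_mx 1%:M 0 y 1%:M) = \det (block_mx (ulsubmx A + b *m y) b 0 S).
  congr (\det _); rewrite {1}schur_blockE mulmx_block !mulmx1 !mulmx0 !add0r.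
  by rewrite /y !mulmxN mulKVmx// subrr.
rewrite det_mulmx det_lblock det_ublock !det1 !mulr1 det_mx11 => H.
apply: mx11_eq; rewrite [RHS]mxE eqxx mulr1n /d H mulfK//.
by rewrite gt_eqF.
Qed.

(* Completing the square in the first variable. *)
Lemma qf_schur (x : R) v : qf A (col_mx x%:M v) = d * x ^+ 2 + qf S (v - x *: y).
Proof.
have -> : col_mx x%:M v = x *: col_mx 1%:M y + col_mx 0 (v - x *: y).
  rewrite scale_col_mx add_col_mx addr0 [x *: y + _]addrC subrK; congr col_mx.
  by rewrite scalemx1.
set w := v - x *: y; set u := col_mx 1%:M y; set w' := col_mx 0 w.
have uA : u^T *m A = (col_mx d%:M 0)^T by rewrite -Au trmx_mul Asym.
have E1 : u^T *m A *m u = d%:M.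
  by rewrite uA tr_col_mx mul_row_col trmx0 mul0mx mulmx1 addr0 tr_scalar_mx.
have E2 : w'^T *m A *m u = 0.
  by rewrite -mulmxA Au tr_col_mx mul_row_col trmx0 mul0mx mulmx0 addr0.
have E3 : u^T *m A *m w' = 0.
  by rewrite uA tr_col_mx mul_row_col trmx0 mul0mx mulmx0 addr0.
have E4 : w'^T *m A *m w' = w^T *m S *m w.
  rewrite {1}schur_blockE tr_col_mx trmx0 mul_row_block !mul0mx !add0r.
  by rewrite mul_row_col mulmx0 add0r.
rewrite /qf [(x *: u + w')^T]linearD /= mulmxDr !mulmxDl [(x *: u)^T]linearZ /=.
rewrite -!scalemxAl -!scalemxAr E1 E2 E3 E4 !scaler0 addr0 add0r.
rewrite mxE; congr (_ + _); rewrite 2!mxE (_ : d%:M 0 0 = d); first by ring.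
by rewrite mxE eqxx mulr1n.
Qed.

(** At the vector (1, y) the completed square vanishes and [qf A] equals [d]. *)
Lemma schur_pivot_gt0 : posdef A -> 0 < d.
Proof.
move=> /(_ (col_mx 1%:M y)); rewrite qf_schur scale1r subrr expr1n mulr1.
rewrite [qf S 0]mxE big1 ?addr0; last by move=> i _; rewrite [X in _ * X]mxE mulr0.
by apply; rewrite col_mx_eq0 negb_and oner_eq0.
Qed.

End Schur.
End QuadraticForms.

(** * Gaussian box sums in several variables *)

Section GaussianBox.
Variable R : realType.
Local Notation mu := (@lebesgue_measure R).
Local Notation I01 := (`[0%R, 1%R]%classic : set R).

Definition colv n (s : seq R) : 'cV[R]_n := \col_i s`_i.
Definition ivec n (p : 'I_n -> int) : 'cV[R]_n := \col_i (p i)%:~R.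

Lemma UC_gauss m n (A : 'M[R]_n) a : UC m (fun s => expR (- qf A (colv n s + a))).
Proof.
apply/UC_expR/UCN.
under [X in UC _ X]eq_fun => s.
  rewrite qfE; under eq_bigr => i _.
    under eq_bigr => j _ do rewrite !mxE.
    over.
  over.
have h (i : 'I_n) : UC m (fun s => s`_i + a i 0) by apply: UCD; [exact: UC_nth|exact: UC_cst].
apply: UC_sum => i _; apply: UC_sum => j _; apply: UCM => //.
by apply: UCM => //; exact: UC_cst.
Qed.

Definition zcons n (z : int) (p : 'I_n -> int) (j : 'I_n.+1) : int :=
  if unlift ord0 j is Some j' then p j' else z.

Lemma big_boxset_recl (V : nmodType) n N (F : ('I_n.+1 -> int) -> V) :
  \sum_(p <- boxset n.+1 N) F p =
  \sum_(i < 2 * N + 1) \sum_(p <- boxset n N) F (zcons (i%:Z - N%:Z) p).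
Proof.
rewrite big_boxset; under [RHS]eq_bigr do rewrite big_boxset.
rewrite pair_big /=.
pose h (iq : 'I_(2 * N + 1) * {ffun 'I_n -> 'I_(2 * N + 1)}) : {ffun 'I_n.+1 -> 'I_(2 * N + 1)} :=
  [ffun j => if unlift ord0 j is Some j' then iq.2 j' else iq.1].
pose g (q : {ffun 'I_n.+1 -> 'I_(2 * N + 1)}) :=
  (q ord0, [ffun j => q (lift ord0 j)] : {ffun 'I_n -> 'I_(2 * N + 1)}).
rewrite (reindex h) /=; last first.
  exists g => [[i q] _|q _]; rewrite /h /g /=.
    rewrite ffunE unlift_none; congr pair; apply/ffunP => j.
    by rewrite !ffunE liftK.
  by apply/ffunP => j; rewrite ffunE; case: unliftP => [j' ->|->] /=; rewrite ?ffunE.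
apply: eq_bigr => iq _; congr F; apply/funext => j.
by rewrite /zcons /h ffunE; case: unliftP.
Qed.

Lemma colv_cons n x s z (p : 'I_n -> int) (a : 'cV[R]_(1 + n)) :
  colv n.+1 (x :: s) + ivec (zcons z p) + a =
  col_mx (x + (z%:~R + a 0 0))%:M (colv n s + (ivec p + dsubmx a)) :> 'cV[R]_(1 + n).
Proof.
apply/matrixP => i j; rewrite ord1 {j} !mxE; case: (splitP i) => k ik.
  rewrite ord1 in ik *; have -> : i = ord0 by exact: val_inj.
  by rewrite /zcons unlift_none mxE eqxx mulr1n addrA.
have -> : i = rshift 1 k by exact: val_inj.
have rl : rshift 1 k = lift ord0 k :> 'I_n.+1 by exact: val_inj.
by rewrite !mxE /= addrA /zcons rl liftK.
Qed.

(* The unit cube and its translates by the box tile [-N, N+1]^n. *)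
Definition gaussbox n (A : 'M[R]_n) N a :=
  \sum_(p <- boxset n N) boxint n (fun s => expR (- qf A (colv n s + (ivec p + a)))).

(* The Gaussian integral of [exp (- qf A v)] over R^n. *)
Definition gaussconst n (A : 'M[R]_n) := Num.sqrt (pi ^+ n / \det A).

(** Completing the square splits off a Gaussian in the first variable x; what remains is a box sum
    for [S] whose shift moves with x. This is why [gaussbox] carries a shift. Integrability is
    recorded for the comparison of integrals. *)
Lemma gaussbox_recl n (A : 'M[R]_(1 + n)) (S := drsubmx A)
    (y := - (invmx S *m (ursubmx A)^T)) (d := \det A / \det S) N
    (a : 'cV[R]_(1 + n)) (a0 := a 0 0) :
  A^T = A -> 0 < \det S ->
  gaussbox A N a = \sum_(i < 2 * N + 1) \int[mu]_(x in I01)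
    (expR (- (d * (x + ((i%:Z - N%:Z)%:~R + a0)) ^+ 2)) *
     gaussbox S N (dsubmx a - (x + ((i%:Z - N%:Z)%:~R + a0)) *: y)) /\
  forall z : int, mu.-integrable I01 (EFin \o (fun x : R =>
    (expR (- (d * (x + (z%:~R + a0)) ^+ 2)) *
     gaussbox S N (dsubmx a - (x + (z%:~R + a0)) *: y)))).
Proof.
move=> Asym dS.
have E z x p s : expR (- qf A (colv n.+1 (x :: s) + (ivec (zcons z p) + a))) =
    expR (- (d * (x + (z%:~R + a0)) ^+ 2)) *
    expR (- qf S (colv n s + (ivec p + (dsubmx a - (x + (z%:~R + a0)) *: y)))).
  by rewrite addrA colv_cons qf_schur// -expRD opprD !addrA.
pose F z s := \sum_(p <- boxset n N) expR (- qf A (colv n.+1 s + (ivec (zcons z p) + a))).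
have UF z : UC n.+1 (F z) by apply: UC_sum => p _; exact: UC_gauss.
have FE z x : boxint n (fun s => F z (x :: s)) =
    expR (- (d * (x + (z%:~R + a0)) ^+ 2)) *
    gaussbox S N (dsubmx a - (x + (z%:~R + a0)) *: y).
  rewrite /gaussbox -boxint_sum; last by move=> p _; exact: UC_gauss.
  rewrite -boxintZ; last by apply: UC_sum => p _; exact: UC_gauss.
  by apply: eq_boxint => s _; rewrite /F mulr_sumr; apply: eq_bigr => p _; rewrite E.
split=> [|z]; last first.
  by have := (@boxint_linear R n).2 _ (UF z);
    congr (is_true (integrable _ _ (EFin \o _))); apply/funext => x; exact: FE.
rewrite /gaussbox big_boxset_recl; apply: eq_bigr => i _.
rewrite -boxint_sum; last by move=> p _; exact: UC_gauss.
by rewrite /=; apply: eq_Rintegral => x _; rewrite -FE.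
Qed.

Lemma gaussbox_ge0 n (A : 'M[R]_n) N a : 0 <= gaussbox A N a.
Proof. by apply: sumr_ge0 => p _; apply: boxint_ge0 => s _; exact: expR_ge0. Qed.

Lemma integrable_gauss1 (d b : R) :
  mu.-integrable I01 (EFin \o (fun x : R => expR (- (d * (x + b) ^+ 2)))).
Proof.
apply: ((@boxint_linear R 0).2 (fun s => expR (- (d * (s`_0 + b) ^+ 2)))).
have h : UC 1 (fun s : seq R => s`_0 + b) by apply: UCD; [exact: UC_nth|exact: UC_cst].
by apply: UC_expR; apply: UCN; apply: UCM; [exact: UC_cst|exact: UCM].
Qed.

Lemma norm_centered_le M (i : 'I_(2 * M + 1)) : `|(i%:Z - M%:Z)%:~R| <= M%:R :> R.
Proof.
rewrite -intr_norm (_ : M%:R = M%:Z%:~R); last by rewrite -pmulrn.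
by rewrite ler_int ler_norml; have := ltn_ord i; lia.
Qed.

(** Induction through the Schur complement, with [gaussconst A = gaussconst S * sqrt (pi / d)]. The
    moving shift rules out an exact formula on a finite box, hence an upper bound for all shifts and
    a lower bound uniform on bounded ones. Positivity of the determinant comes out of the same
    induction, as d times det S. *)
Lemma gaussbox_cvg n (A : 'M[R]_n) : A^T = A -> posdef A -> [/\ 0 < \det A,
  forall N a, gaussbox A N a <= gaussconst A &
  forall e K, 0 < e -> exists N0, forall N, (N0 <= N)%N -> forall a : 'cV[R]_n,
    (forall i, `|a i 0| <= K) -> gaussconst A - e <= gaussbox A N a].
Proof.
elim: n A => [|n IH] A Asym Apd.
  have C1 : gaussconst A = 1 by rewrite /gaussconst det_mx00 expr0 divr1 sqrtr1.
  have G1 N a : gaussbox A N a = 1.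
    rewrite /gaussbox big_boxset (eq_bigr (fun=> 1)) => [|q _].
      by rewrite sumr_const card_ffun !card_ord expn0.
    by rewrite /= qfE big_ord0 oppr0 expR0.
  rewrite C1; split=> [|N a|e K e0]; rewrite ?det_mx00 ?G1//.
  by exists 0%N => N _ a _; rewrite G1 gerBl ltW.
pose A' : 'M[R]_(1 + n) := A; pose S := drsubmx A'.
have [dS Sle Sge] := IH S (schur_sym (A := A') Asym) (schur_posdef (A := A') Asym Apd).
pose y := - (invmx S *m (ursubmx A')^T); pose d := \det A / \det S.
have d0 : 0 < d := schur_pivot_gt0 (A := A') Asym dS Apd.
have dA : 0 < \det A by have := mulr_gt0 d0 dS; rewrite /d divfK// gt_eqF.
pose c := Num.sqrt (pi / d).
have CE : gaussconst A = gaussconst S * c.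
  rewrite /gaussconst /c -sqrtrM ?divr_ge0 ?exprn_ge0 ?pi_ge0 ?(ltW dS)//; congr Num.sqrt.
  by rewrite /d exprS; field; rewrite !gt_eqF.
have C0 : 0 < gaussconst S by rewrite sqrtr_gt0 divr_gt0// exprn_gt0// pi_gt0.
have c0 : 0 < c by rewrite sqrtr_gt0 divr_gt0// pi_gt0.
have [gle gge] := sum_gauss1 d0.
split=> // [N a|e K e0].
  have [-> hi] := @gaussbox_recl n A' N a Asym dS.
  rewrite CE (le_trans _ (ler_wpM2l (ltW C0) (gle N (a 0 0))))// mulr_sumr ler_sum// => i _.
  rewrite -RintegralZl//; last exact: integrable_gauss1.
  apply: le_Rintegral => //.
    by apply: (@integrableZl _ _ R mu _ _ _ _ (integrable_gauss1 _ _)).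
  by move=> x _; rewrite mulrC ler_wpM2r ?expR_ge0// Sle.
(* Chosen so that (C - e') (c - e') >= C c - e' (C + c) >= C c - e, where C is [gaussconst S]; e' <=
   C keeps the first factor nonnegative. *)
pose e' := Num.min (e / (gaussconst S + c)) (gaussconst S).
have Cc0 : 0 < gaussconst S + c by rewrite addr_gt0.
have e'0 : 0 < e' by rewrite lt_min divr_gt0.
have e'S : e' <= gaussconst S by rewrite ge_min lexx orbT.
have e'e : e' * (gaussconst S + c) <= e by rewrite -ler_pdivlMr// ge_min lexx.
have [M hM] := gge e' K e'0.
(* The outer range [M] is fixed before [N0]: for a first coordinate in that range, |x + z + a_0| <=
   1 + M + |K|, which bounds the inner shifts. *)
have [N0 hN0] := Sge e' (`|K| + (1 + M%:R + `|K|) * \sum_i `|y i 0|) e'0.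
exists (maxn M N0) => N; rewrite geq_max => /andP[MN N0N] a aK.
have [-> hi] := @gaussbox_recl n A' N a Asym dS.
have K0 : 0 <= K := le_trans (normr_ge0 _) (aK ord0).
(* All integrals are nonnegative, so the outer sum may be cut from [N] down to [M] while the inner
   sums keep [N]. *)
apply: le_trans (le_sum_centered (F := fun z => \int[mu]_(x in I01)
    (expR (- (d * (x + (z%:~R + a 0 0)) ^+ 2)) *
     gaussbox S N (dsubmx (a : 'cV_(1 + n)) - (x + (z%:~R + a 0 0)) *: y))) _ MN); last first.
  by move=> z; apply: Rintegral_ge0 => x _; rewrite mulr_ge0 ?expR_ge0 ?gaussbox_ge0.
apply: (@le_trans _ _ ((gaussconst S - e') * (c - e'))).
  rewrite CE -subr_ge0.
  have -> : (gaussconst S - e') * (c - e') - (gaussconst S * c - e) =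
    e - e' * (gaussconst S + c) + e' * e' by ring.
  by rewrite addr_ge0 ?subr_ge0// mulr_ge0// ltW.
apply: (le_trans (ler_wpM2l _ (hM (a 0 0) (aK ord0)))); first by rewrite subr_ge0.
rewrite mulr_sumr ler_sum// => i _.
rewrite -RintegralZl//; last exact: integrable_gauss1.
apply: le_Rintegral => //.
  by apply: (@integrableZl _ _ R mu _ _ _ _ (integrable_gauss1 _ _)).
move=> x; rewrite /= in_itv /= => /andP[x0 x1].
rewrite [leRHS]mulrC ler_wpM2r ?expR_ge0// hN0// => j.
clear hi; clearbody y; rewrite !mxE (le_trans (ler_normB _ _))// lerD//.
  by rewrite [leRHS]ger0_norm//; exact: aK.
rewrite normrM ler_pM//.
  have h1 : `|x| <= 1 by rewrite ger0_norm.
  have h2 : `|(i%:Z - M%:Z)%:~R| <= M%:R :> R by exact: norm_centered_le.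
  have h3 : `|a 0 0| <= `|K| by rewrite [leRHS]ger0_norm.
  rewrite -addrA (le_trans (ler_normD _ _))// lerD// (le_trans (ler_normD _ _))// lerD//.
by rewrite (bigD1 j)//= lerDl sumr_ge0.
Qed.

End GaussianBox.

(** * Complex-valued integrands *)

Section ComplexBoxIntegral.
Variable R : realType.
Local Notation C := R[i].
Implicit Types (F G : seq R -> C) (n : nat).

Lemma Re_mulc (z w : C) : complex.Re (z * w) =
  complex.Re z * complex.Re w - complex.Im z * complex.Im w.
Proof. by case: z; case: w. Qed.

Lemma Im_mulc (z w : C) : complex.Im (z * w) =
  complex.Re z * complex.Im w + complex.Im z * complex.Re w.
Proof. by case: z => a b; case: w => c d. Qed.

Lemma Re_addc (z w : C) : complex.Re (z + w) = complex.Re z + complex.Re w.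
Proof. by case: z; case: w. Qed.

Lemma Im_addc (z w : C) : complex.Im (z + w) = complex.Im z + complex.Im w.
Proof. by case: z; case: w. Qed.

Lemma Re_conjc (z : C) : complex.Re z^* = complex.Re z.
Proof. by case: z. Qed.

Lemma Im_conjc (z : C) : complex.Im z^* = - complex.Im z.
Proof. by case: z. Qed.

Lemma complex_eq (z w : C) : complex.Re z = complex.Re w -> complex.Im z = complex.Im w -> z = w.
Proof. by case: z => a b; case: w => c d /= -> ->. Qed.

Lemma Re_ci : complex.Re ('i : C) = 0. Proof. by rewrite -complexiE. Qed.
Lemma Im_ci : complex.Im ('i : C) = 1. Proof. by rewrite -complexiE. Qed.

Lemma normC_le (z : C) (e : R) : `|complex.Re z| <= e -> `|complex.Im z| <= e ->
  `|z| <= (2 * e)%:C.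
Proof.
move=> h1 h2; rewrite [z]complexE (le_trans (ler_normD _ _))// mulr_natl mulr2n rmorphD.
have nr (x : R) : `|x%:C| = `|x|%:C :> C.
  by rewrite normc_def /= expr0n addr0 sqrtr_sqr.
rewrite normrM !nr lerD ?lecR//.
by rewrite (_ : `|'i%C| = 1 :> C) ?mul1r ?lecR// normc_def /= expr0n add0r expr1n sqrtr1.
Qed.

Definition cUC n F : Prop := UC n (fun s => complex.Re (F s)) /\ UC n (fun s => complex.Im (F s)).

Lemma cUC_eq n F G : (forall s, inbox n s -> F s = G s) -> cUC n F -> cUC n G.
Proof.
move=> FG [F1 F2]; split; [apply: UC_eq F1|apply: UC_eq F2] => s sb; by rewrite FG.
Qed.

Lemma cUC_cst n c : cUC n (fun=> c).
Proof. by split; exact: UC_cst. Qed.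

Lemma cUC_realC n (F : seq R -> R) : UC n F -> cUC n (fun s => (F s)%:C).
Proof. by move=> hF; split => //=; exact: UC_cst. Qed.

Lemma cUCD n F G : cUC n F -> cUC n G -> cUC n (fun s => F s + G s).
Proof.
move=> [F1 F2] [G1 G2]; split.
  by apply: UC_eq (UCD F1 G1) => s _; rewrite Re_addc.
by apply: UC_eq (UCD F2 G2) => s _; rewrite Im_addc.
Qed.

Lemma cUCM n F G : cUC n F -> cUC n G -> cUC n (fun s => F s * G s).
Proof.
move=> [F1 F2] [G1 G2]; split.
  by apply: UC_eq (UCD (UCM F1 G1) (UCN (UCM F2 G2))) => s _; rewrite Re_mulc.
by apply: UC_eq (UCD (UCM F1 G2) (UCM F2 G1)) => s _; rewrite Im_mulc.
Qed.

Lemma cUC_sum n (I : Type) (r : seq I) (P : pred I) (F : I -> seq R -> C) :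
  (forall i, P i -> cUC n (F i)) -> cUC n (fun s => \sum_(i <- r | P i) F i s).
Proof.
move=> hF; elim: r => [|i r IH].
  by apply: cUC_eq (cUC_cst n 0) => s _; rewrite big_nil.
case: (boolP (P i)) => Pi.
  by apply: cUC_eq (cUCD (hF _ Pi) IH) => s _; rewrite big_cons Pi.
by apply: cUC_eq IH => s _; rewrite big_cons (negbTE Pi).
Qed.

Lemma cUC_prod n (I : Type) (r : seq I) (P : pred I) (F : I -> seq R -> C) :
  (forall i, P i -> cUC n (F i)) -> cUC n (fun s => \prod_(i <- r | P i) F i s).
Proof.
move=> hF; elim: r => [|i r IH].
  by apply: cUC_eq (cUC_cst n 1) => s _; rewrite big_nil.
case: (boolP (P i)) => Pi.
  by apply: cUC_eq (cUCM (hF _ Pi) IH) => s _; rewrite big_cons Pi.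
by apply: cUC_eq IH => s _; rewrite big_cons (negbTE Pi).
Qed.

Lemma cUC_conj n F : cUC n F -> cUC n (fun s => (F s)^*).
Proof.
move=> [F1 F2]; split.
  by apply: UC_eq F1 => s _; rewrite Re_conjc.
by apply: UC_eq (UCN F2) => s _; rewrite Im_conjc.
Qed.

Lemma cUC_limit n F : (forall e : R, 0 < e -> exists2 G, cUC n G &
    forall s, inbox n s -> `|F s - G s| <= e%:C) -> cUC n F.
Proof.
move=> H; split; apply: UC_limit => e /H[G [G1 G2] FG].
  exists (fun s => complex.Re (G s)) => // s sb; rewrite -lecR (le_trans _ (FG s sb))//.
  by rewrite (le_trans _ (normc_ge_Re _))//; case: (F s) => a b; case: (G s).
exists (fun s => complex.Im (G s)) => // s sb; rewrite -lecR (le_trans _ (FG s sb))//.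
by rewrite (le_trans _ (norm_Im_le _))//; case: (F s) => a b; case: (G s).
Qed.

Lemma cexpE (z : C) :
  cexp z = (expR (complex.Re z) * cos (complex.Im z)) +i* (expR (complex.Re z) * sin (complex.Im z)).
Proof.
rewrite /cexp -complexiE; apply: complex_eq;
  by rewrite /= ?(mulr0, mul0r, mul1r, addr0, subr0, add0r).
Qed.

Lemma cUC_cexp n F : cUC n F -> cUC n (fun s => cexp (F s)).
Proof.
move=> [F1 F2]; split.
  by apply: UC_eq (UCM (UC_expR F1) (UC_cos F2)) => s _; rewrite cexpE.
by apply: UC_eq (UCM (UC_expR F1) (UC_sin F2)) => s _; rewrite cexpE.
Qed.

Lemma cexpD (z w : C) : cexp (z + w) = cexp z * cexp w.
Proof.
rewrite !cexpE Re_addc Im_addc; apply: complex_eq => /=; rewrite expRD ?cosD ?sinD; ring.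
Qed.

Lemma cexp0 : cexp (0 : C) = 1.
Proof. by rewrite cexpE /= expR0 cos0 sin0 mulr0 mulr1. Qed.

Lemma cexp_sum (I : Type) (r : seq I) (P : pred I) (F : I -> C) :
  cexp (\sum_(i <- r | P i) F i) = \prod_(i <- r | P i) cexp (F i).
Proof. by rewrite (big_morph _ cexpD cexp0). Qed.

Lemma cexp_realC (x : R) : cexp x%:C = (expR x)%:C.
Proof. by rewrite cexpE /= cos0 sin0 mulr0 mulr1. Qed.

Lemma cexp_conj (z : C) : (cexp z)^* = cexp z^*.
Proof.
rewrite !cexpE; apply: complex_eq; rewrite ?Re_conjc ?Im_conjc /= ?Re_conjc ?Im_conjc ?cosN//.
by rewrite sinN mulrN.
Qed.

Lemma normC_cexp (z : C) : `|cexp z| = (expR (complex.Re z))%:C.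
Proof.
rewrite cexpE normc_def /=; congr (_%:C).
by rewrite !exprMn -mulrDr cos2Dsin2 mulr1 sqrtr_sqr ger0_norm// expR_ge0.
Qed.

(** Real and imaginary parts are integrated separately, the shape in which [ipH] is given. *)
Definition cboxint n F : C :=
  (boxint n (fun s => complex.Re (F s)))%:C + 'i * (boxint n (fun s => complex.Im (F s)))%:C.

Lemma Re_cboxint n F : complex.Re (cboxint n F) = boxint n (fun s => complex.Re (F s)).
Proof. by rewrite /cboxint -complexiE /= !(mul0r, mulr0, mul1r, subr0, addr0). Qed.

Lemma Im_cboxint n F : complex.Im (cboxint n F) = boxint n (fun s => complex.Im (F s)).
Proof. by rewrite /cboxint -complexiE /= !(mul0r, mulr0, mul1r, subr0, addr0, add0r). Qed.

Lemma eq_cboxint n F G : (forall s, inbox n s -> F s = G s) -> cboxint n F = cboxint n G.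
Proof. by move=> FG; congr (_%:C + _ * _%:C); apply: eq_boxint => s sb; rewrite FG. Qed.

Lemma cboxint_realC n (F : seq R -> R) : cboxint n (fun s => (F s)%:C) = (boxint n F)%:C.
Proof. by rewrite /cboxint /= boxint_cst mulr0 addr0. Qed.

Lemma cboxint_cst n c : cboxint n (fun=> c) = c.
Proof. by apply: complex_eq; rewrite ?Re_cboxint ?Im_cboxint boxint_cst. Qed.

Lemma cboxintD n F G : cUC n F -> cUC n G ->
  cboxint n (fun s => F s + G s) = cboxint n F + cboxint n G.
Proof.
move=> [F1 F2] [G1 G2]; apply: complex_eq; rewrite !(Re_addc, Im_addc, Re_cboxint, Im_cboxint).
  by rewrite -boxintD//; apply: eq_boxint => s _; rewrite Re_addc.
by rewrite -boxintD//; apply: eq_boxint => s _; rewrite Im_addc.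
Qed.

Lemma cboxintZ n c F : cUC n F -> cboxint n (fun s => c * F s) = c * cboxint n F.
Proof.
move=> [F1 F2]; apply: complex_eq; rewrite !(Re_mulc, Im_mulc, Re_cboxint, Im_cboxint).
  rewrite -!boxintZ// -boxintB; [|by apply: UCM => //; exact: UC_cst..].
  by apply: eq_boxint => s _; rewrite Re_mulc.
rewrite -!boxintZ// -boxintD; [|by apply: UCM => //; exact: UC_cst..].
by apply: eq_boxint => s _; rewrite Im_mulc.
Qed.

Lemma cboxint_sum n (I : Type) (r : seq I) (P : pred I) (F : I -> seq R -> C) :
  (forall i, P i -> cUC n (F i)) ->
  cboxint n (fun s => \sum_(i <- r | P i) F i s) = \sum_(i <- r | P i) cboxint n (F i).
Proof.
move=> hF; elim: r => [|i r IH].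
  by rewrite big_nil -[RHS](cboxint_cst n); apply: eq_cboxint => s _; rewrite big_nil.
rewrite big_cons -IH; case: ifP => Pi.
  rewrite -cboxintD; [|exact: hF|exact: cUC_sum].
  by apply: eq_cboxint => s _; rewrite big_cons Pi.
by apply: eq_cboxint => s _; rewrite big_cons Pi.
Qed.

(** The factor 2 is the price of estimating real and imaginary parts separately. *)
Lemma cboxint_close n F G (e : R) : cUC n F -> cUC n G ->
  (forall s, inbox n s -> `|F s - G s| <= e%:C) -> `|cboxint n F - cboxint n G| <= (2 * e)%:C.
Proof.
move=> [F1 F2] [G1 G2] FG.
have bd (f g : seq R -> R) : UC n f -> UC n g ->
    (forall s, inbox n s -> `|f s - g s| <= e) -> `|boxint n f - boxint n g| <= e.
  move=> hf hg fg; rewrite -boxintB// ler_norml.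
  have hB : UC n (fun s => f s - g s) by apply: UCD => //; exact: UCN.
  rewrite -{1}(boxint_cst n (- e)) -{2}(boxint_cst n e).
  by apply/andP; split; apply: le_boxint => //; try exact: UC_cst;
    move=> s /fg; rewrite ler_norml => /andP[].
have ReB (z w : C) : complex.Re (z - w) = complex.Re z - complex.Re w by case: z; case: w.
have ImB (z w : C) : complex.Im (z - w) = complex.Im z - complex.Im w by case: z; case: w.
apply: normC_le; rewrite ?(ReB, ImB) ?(Re_cboxint, Im_cboxint); apply: bd => // s sb.
  by rewrite -ReB -lecR (le_trans (normc_ge_Re _))// FG.
by rewrite -ImB -lecR (le_trans (norm_Im_le _))// FG.
Qed.

Lemma cboxint_cat m n (F : seq R -> C) :
  cboxint (m + n) F = cboxint m (fun s => cboxint n (fun t => F (s ++ t))).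
Proof.
by apply: complex_eq; rewrite ?Re_cboxint ?Im_cboxint boxint_cat;
  apply: eq_boxint => s _; rewrite ?Re_cboxint ?Im_cboxint.
Qed.

Lemma cboxintM m n F G : cUC m F -> cUC n G ->
  cboxint m (fun s => cboxint n (fun t => F s * G t)) = cboxint m F * cboxint n G.
Proof.
move=> hF hG; rewrite [RHS]mulrC -cboxintZ//; apply: eq_cboxint => s _.
by rewrite cboxintZ// mulrC.
Qed.

(** For a product of one-variable functions no exchange of integrals occurs: each factor is a
    constant for the inner integrals and is pulled out. *)
Lemma cboxint_prod n (f : 'I_n -> R -> C) :
  (forall i m j, cUC m (fun s => f i s`_j)) ->
  cboxint n (fun s => \prod_(i < n) f i s`_i) = \prod_(i < n) cboxint 1 (fun s => f i s`_0).
Proof.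
elim: n f => [|n IH] f hf.
  by rewrite big_ord0 -[RHS](cboxint_cst 0); apply: eq_cboxint => s _; rewrite big_ord0.
rewrite big_ord_recl -(IH (fun i => f (lift ord0 i)))// -cboxintM//; last exact: cUC_prod.
rewrite (@cboxint_cat 1 n); apply: eq_cboxint => -[|x [|]]// _; apply: eq_cboxint => t _.
by rewrite /= big_ord_recl.
Qed.

Lemma cos_sin_2piz (z : int) : cos (2 * pi * z%:~R) = 1 :> R /\ sin (2 * pi * z%:~R) = 0 :> R.
Proof.
have H (n : nat) : cos (2 * pi * n%:R) = 1 :> R /\ sin (2 * pi * n%:R) = 0 :> R.
  elim: n => [|n [c1 s1]]; first by rewrite mulr0 cos0 sin0.
  have c2 : cos (2 * pi) = 1 :> R by rewrite mulr_natl cos2pi.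
  have s2 : sin (2 * pi) = 0 :> R by rewrite mulr_natl sin2pi.
  by rewrite -[n.+1]addn1 natrD mulrDr mulr1 cosD sinD c1 s1 c2 s2; split; ring.
case: z => n; first by rewrite -pmulrn.
by rewrite NegzE mulrNz -pmulrn mulrN cosN sinN; have [-> ->] := H n.+1; rewrite oppr0.
Qed.

(** For z != 0 the primitives of cos and sin at frequency 2 pi z take equal values at 0 and 1. *)
Lemma cboxint_char (z : int) :
  cboxint 1 (fun s : seq R => cexp (2%:R * pi%:C * 'i * (z%:~R * (s`_0)%:C))) = (z == 0)%:R.
Proof.
have [->|z0] := eqVneq z 0.
  rewrite -[RHS](cboxint_cst 1); apply: eq_cboxint => s _.
  by rewrite mulr0z mul0r mulr0 cexp0.
set w : R := 2 * pi * z%:~R.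
have w0 : w != 0 by rewrite mulf_neq0 ?intr_eq0// mulf_neq0// gt_eqF// pi_gt0.
have [cw sw] := cos_sin_2piz z; rewrite -/w in cw sw.
have E (x : R) : cexp (2%:R * pi%:C * 'i * (z%:~R * x%:C)) = cos (w * x) +i* sin (w * x).
  have -> : 2%:R * pi%:C * 'i * (z%:~R * x%:C) = 'i * (w * x)%:C.
    by rewrite /w !rmorphM /= rmorph_int rmorph_nat; ring.
  rewrite cexpE Re_mulc Im_mulc Re_ci Im_ci /= !(mul0r, mulr0, mul1r, subr0, add0r, addr0).
  by rewrite expR0 !mul1r.
have dl (x : R) : is_derive x (1 : R) (fun x : R => w * x) w.
  have := @is_deriveZ R R R id w x 1 1 _; rewrite /GRing.scale /= mulr1; apply.
have cl : continuous (fun x : R => w * x) by move=> x; apply: cvgM; [exact: cvg_cst|exact: cvg_id].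
rewrite (eq_cboxint (fun s _ => E s`_0)).
apply: complex_eq; rewrite ?Re_cboxint ?Im_cboxint /=.
  have dF (x : R) : is_derive x (1 : R) (fun x => w^-1 * sin (w * x)) (cos (w * x)).
    have h := @is_derive1_comp R sin (fun x => w * x) x _ _ (is_derive_sin _) (dl x).
    have := @is_deriveZ R R R _ w^-1 x 1 _ h; rewrite /GRing.scale /=.
    by rewrite mulrCA mulVf// mulr1.
  rewrite (Rintegral01_FTC dF).
    by rewrite mulr1 mulr0 sw sin0 mulr0 subrr.
  by move=> x; apply: (continuous_comp (cl x)); exact: continuous_cos.
have dF (x : R) : is_derive x (1 : R) (fun x => - w^-1 * cos (w * x)) (sin (w * x)).
  have h := @is_derive1_comp R cos (fun x => w * x) x _ _ (is_derive_cos _) (dl x).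
  have := @is_deriveZ R R R _ (- w^-1) x 1 _ h; rewrite /GRing.scale /=.
  by rewrite !mulNr mulrN opprK mulrCA mulVf// mulr1.
rewrite (Rintegral01_FTC dF).
  by rewrite mulr1 mulr0 cw cos0 subrr.
by move=> x; apply: (continuous_comp (cl x)); exact: continuous_sin.
Qed.

End ComplexBoxIntegral.

(** * Theta series *)

Section Coercivity.
Variable R : realType.

(** Induction along the Schur complement, with an explicit constant and without compactness of the
    sphere. *)
Lemma posdef_coercive n (A : 'M[R]_n) : A^T = A -> posdef A ->
  exists2 c, 0 < c & forall v : 'cV[R]_n, c * (\sum_i v i 0 ^+ 2) <= qf A v.
Proof.
elim: n A => [|n IH] A Asym Apd.
  by exists 1 => // v; rewrite qfE !big_ord0 mulr0.
pose A' : 'M[R]_(1 + n) := A; pose S := drsubmx A'.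
have Ssym := schur_sym (A := A') Asym; have Spd := schur_posdef (A := A') Asym Apd.
have [dS _ _] := gaussbox_cvg Ssym Spd.
have [c1 c10 hc1] := IH S Ssym Spd.
pose y := - (invmx S *m (ursubmx A')^T); pose d := \det A / \det S.
have d0 : 0 < d := schur_pivot_gt0 (A := A') Asym dS Apd.
have qfS x v : qf A' (col_mx x%:M v) = d * x ^+ 2 + qf S (v - x *: y).
  exact: (qf_schur (A := A') Asym dS).
clearbody y d.
pose Y := \sum_i y i 0 ^+ 2; have Y0 : 0 <= Y by apply: sumr_ge0 => i _; exact: sqr_ge0.
(* From |w|^2 <= 2 |w - x y|^2 + 2 x^2 Y it suffices that 2 c <= c1 and c (2 Y + 1) <= d. *)
pose c := Num.min (c1 / 2) (d / (2 * Y + 1)).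
have c0 : 0 < c by rewrite lt_min !divr_gt0// ltr_wpDl// mulr_ge0.
have cc1 : 2 * c <= c1 by rewrite mulrC -ler_pdivlMr// ge_min lexx.
have cd : c * (2 * Y + 1) <= d.
  by rewrite -ler_pdivlMr ?ge_min ?lexx ?orbT// ltr_wpDl// mulr_ge0.
exists c => // v; pose x := v ord0 0; pose w : 'cV[R]_n := dsubmx (v : 'cV_(1 + n)).
have vE : (v : 'cV_(1 + n)) = col_mx x%:M w.
  apply: etrans (esym (@vsubmxK R 1 n 1 v)) _; congr col_mx; apply: mx11_eq.
  by rewrite !mxE eqxx mulr1n; congr (v _ _); exact: val_inj.
have -> : \sum_i v i 0 ^+ 2 = x ^+ 2 + \sum_i w i 0 ^+ 2.
  rewrite big_ord_recl; congr (_ + _); apply: eq_bigr => i _.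
  by rewrite mxE; congr (v _ _ ^+ 2); exact: val_inj.
have -> : qf A v = d * x ^+ 2 + qf S (w - x *: y) by rewrite -qfS; congr (qf A' _).
apply: (@le_trans _ _ (d * x ^+ 2 + c1 * \sum_i (w - x *: y) i 0 ^+ 2)); last by rewrite lerD2l hc1.
clear vE; clearbody w x; set u := \sum_i (w - x *: y) i 0 ^+ 2.
have u0 : 0 <= u by apply: sumr_ge0 => i _; exact: sqr_ge0.
have hw : \sum_i w i 0 ^+ 2 <= 2 * u + 2 * x ^+ 2 * Y.
  rewrite /u /Y !mulr_sumr -big_split/= ler_sum// => i _.
  rewrite !mxE; set a := w i 0; set b := y i 0.
  rewrite -subr_ge0 (_ : _ - _ = (a - 2 * x * b) ^+ 2) ?sqr_ge0//; ring.
have x0 := sqr_ge0 x.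
rewrite (@le_trans _ _ (c * (x ^+ 2 + (2 * u + 2 * x ^+ 2 * Y))))//.
  by rewrite ler_wpM2l ?(ltW c0)// lerD2l.
have h1 := ler_wpM2r x0 cd; have h2 := ler_wpM2r u0 cc1.
apply: le_trans (lerD h1 h2); rewrite le_eqVlt; apply/orP; left; apply/eqP; ring.
Qed.

End Coercivity.

(** * Size of the terms of a theta series *)

Section ThetaTerms.
Variables (R : realType) (l : nat).
Local Notation C := R[i].
Implicit Types (mu : 'I_l -> int) (z : 'I_l -> C) (Om : 'M[C]_l).

Definition thterm (k : nat) Om mu z : C :=
  cexp (pi%:C * 'i * (k%:R)^-1 * quadZ Om mu + 2%:R * pi%:C * 'i * dotZC mu z).

Lemma Im_sum (I : Type) (r : seq I) (P : pred I) (F : I -> C) :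
  complex.Im (\sum_(i <- r | P i) F i) = \sum_(i <- r | P i) complex.Im (F i).
Proof. exact: (big_morph _ (@Im_addc R)). Qed.

Lemma intC (m : int) : m%:~R = (m%:~R : R)%:C.
Proof. by rewrite rmorph_int. Qed.

Lemma natC (m : nat) : m%:R = (m%:R : R)%:C.
Proof. by rewrite rmorph_nat. Qed.

Lemma Re_realM (x : R) (w : C) : complex.Re (x%:C * w) = x * complex.Re w.
Proof. by rewrite Re_mulc /= mul0r subr0. Qed.

Lemma Im_realM (x : R) (w : C) : complex.Im (x%:C * w) = x * complex.Im w.
Proof. by rewrite Im_mulc /= mul0r addr0. Qed.

Lemma Re_iM (w : C) : complex.Re ('i * w) = - complex.Im w.
Proof. by rewrite Re_mulc Re_ci Im_ci mul0r mul1r add0r. Qed.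

Lemma Omega2_sym Om : Om^T = Om -> (Omega2 Om)^T = Omega2 Om.
Proof. by move=> Osym; apply/matrixP => i j; rewrite !mxE -{1}Osym mxE. Qed.

Lemma Im_quadZ Om mu : complex.Im (quadZ Om mu) = qf (Omega2 Om) (ivec R mu).
Proof.
rewrite qfE Im_sum; apply: eq_bigr => i _; rewrite Im_sum; apply: eq_bigr => j _.
by rewrite !intC mulrC Im_realM Im_realM !mxE; ring.
Qed.

Lemma Im_dotZC mu z : complex.Im (dotZC mu z) = \sum_i (mu i)%:~R * complex.Im (z i).
Proof. by rewrite Im_sum; apply: eq_bigr => i _; rewrite intC Im_realM. Qed.

Lemma normC_thterm k Om mu z : `|thterm k Om mu z| =
  (expR (- (pi / k%:R * qf (Omega2 Om) (ivec R mu) +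
    2 * pi * \sum_i (mu i)%:~R * complex.Im (z i))))%:C.
Proof.
rewrite normC_cexp; congr (expR _)%:C; rewrite Re_addc.
have -> : pi%:C * 'i * (k%:R)^-1 * quadZ Om mu = (pi / k%:R)%:C * ('i * quadZ Om mu).
  by rewrite natC -fmorphV rmorphM /=; ring.
have -> : 2%:R * pi%:C * 'i * dotZC mu z = (2 * pi)%:C * ('i * dotZC mu z).
  by rewrite natC rmorphM /=; ring.
by rewrite !Re_realM !Re_iM Im_quadZ Im_dotZC; ring.
Qed.

(** Coercivity of [Omega2 Om] lets the quadratic exponent absorb the linear one, coordinate by
    coordinate; the constant depends on z only through the bound [B] on its imaginary part. *)
Lemma thterm_bound k Om (B : R) : (0 < k)%N -> Om^T = Om -> posdef (Omega2 Om) ->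
  exists c : R, forall z, (forall i, `|complex.Im (z i)| <= B) ->
    forall mu, `|thterm k Om mu z| <= (c * geomw R mu)%:C.
Proof.
move=> k0 Osym Opd; have kR : 0 < k%:R :> R by rewrite ltr0n.
have [c0 c00 hc0] : exists2 c, 0 < c & forall v : 'cV[R]_l,
    c * (\sum_i v i 0 ^+ 2) <= qf (Omega2 Om) v.
  by apply: posdef_coercive => //; exact: Omega2_sym.
have pi0 : 0 < pi :> R by exact: pi_gt0.
pose al := pi / k%:R * c0; have al0 : 0 < al by rewrite mulr_gt0// divr_gt0.
(* [be] is the maximum of t m - al m^2 over real m. The extra 1 in [t] leaves a factor exp(- |m|),
   which is at most 2^-|m| because exp 1 >= 2. *)
pose t := 2 * pi * B + 1; pose be := t ^+ 2 / (4 * al).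
exists (expR be ^+ l) => z hz mu; rewrite normC_thterm lecR.
have hexp n : expR (- n%:R) <= 2^-1 ^+ n :> R.
  elim: n => [|n IH]; first by rewrite oppr0 expR0.
  rewrite -[n.+1]add1n natrD opprD expRD exprS ler_pM ?expR_ge0//.
  by rewrite expRN lef_pV2 ?posrE ?expR_gt0//; exact: (expR_ge1Dx 1).
have absE (m : int) : (absz m)%:R = `|m%:~R| :> R by rewrite natr_absz intr_norm.
apply: (@le_trans _ _ (expR (\sum_(i < l) (be - (absz (mu i))%:R)))); last first.
  rewrite expR_sum /geomw -[l in _ ^+ l]card_ord -prodr_const -big_split /= ler_prod// => i _.
  by rewrite expR_ge0 expRD ler_wpM2l ?expR_ge0.
rewrite ler_expR.
apply: (@le_trans _ _ (\sum_(i < l) (- (al * (mu i)%:~R ^+ 2) + 2 * pi * B * (absz (mu i))%:R))).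
  rewrite opprD big_split /= lerD//.
    rewrite sumrN lerN2 -mulr_sumr /al -mulrA ler_wpM2l//; first by rewrite divr_ge0 ?ltW.
    by have := hc0 (ivec R mu); under eq_bigr do rewrite mxE.
  rewrite -mulrN -mulr_sumr -[2 * pi * B]mulrA -!mulrA ler_wpM2l// ler_wpM2l ?(ltW pi0)//.
  rewrite -sumrN mulr_sumr ler_sum// => i _; rewrite absE.
  by rewrite (le_trans (ler_norm _))// normrN normrM mulrC ler_wpM2r.
rewrite ler_sum// => i _; rewrite absE -[(mu i)%:~R ^+ 2]real_normK ?num_real//.
set m := `|_|; rewrite /be -subr_ge0.
have -> : t ^+ 2 / (4 * al) - m - (- (al * m ^+ 2) + 2 * pi * B * m) =
    (2 * al * m - t) ^+ 2 / (4 * al).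
  by rewrite /t; field; rewrite gt_eqF.
by rewrite divr_ge0 ?sqr_ge0// mulr_ge0// ltW.
Qed.

End ThetaTerms.

(** * Classes modulo k delta Z^l and the transform on them *)

Section LatticeClasses.
Variables (R : realType) (l k : nat) (delta : 'I_l -> nat).
Hypotheses (k_gt0 : (0 < k)%N) (delta_gt0 : forall i, (0 < delta i)%N).
Local Notation C := R[i].
Implicit Types (m mu p : 'I_l -> int).

(** Inverse of [latpt] on the class of [m]; elsewhere the division rounds, and applying [latpt]
    again detects it. *)
Definition latdiv m mu : 'I_l -> int := fun i => ((mu i - m i) %/ (k * delta i)%:Z)%Z.

Let kd_neq0 i : (k * delta i)%:Z != 0.
Proof. by rewrite eqz_nat -lt0n muln_gt0 k_gt0 delta_gt0. Qed.

Lemma latptK m : cancel (latpt k delta m) (latdiv m).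
Proof. by move=> p; apply/funext => i; rewrite /latdiv /latpt addrC addKr mulrC mulzK. Qed.

Lemma theta0E m mu : theta0 k delta m mu = (latpt k delta m (latdiv m mu) == mu)%:R :> C.
Proof.
rewrite /theta0; set P := [forall i, _]; rewrite (_ : P = (latpt k delta m (latdiv m mu) == mu)).
  by case: eqP.
apply/forallP/eqP => [H|H i].
  by apply/funext => i; rewrite /latpt mulrC /latdiv divzK// addrC subrK.
have -> : mu i = latpt k delta m (latdiv m mu) i by rewrite H.
by rewrite /latpt addrC addKr dvdz_mulr.
Qed.

Lemma theta0_latpt m p : theta0 k delta m (latpt k delta m p) = 1 :> C.
Proof. by rewrite theta0E latptK eqxx. Qed.

(** The link between [Cab], which sums over all frequencies with coefficients [theta0], and [theta],
    which sums over the parameter of a single class. *)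
Lemma hsum_theta0 m (T : ('I_l -> int) -> C) s :
  hsum (fun mu => theta0 k delta m mu * T mu) s <-> hsum (fun p => T (latpt k delta m p)) s.
Proof.
have T0 mu : latpt k delta m (latdiv m mu) != mu -> theta0 k delta m mu * T mu = 0.
  by move=> /negbTE h; rewrite theta0E h mul0r.
have -> : (fun p => T (latpt k delta m p)) =
    (fun mu => theta0 k delta m mu * T mu) \o latpt k delta m.
  by apply/funext => p /=; rewrite theta0_latpt mul1r.
split; first exact: (hsum_reindex (@latptK m)).
exact: (hsum_reindexV (@latptK m)).
Qed.

Lemma theta0_periodic m mu p : theta0 k delta m (latpt k delta mu p) = theta0 k delta m mu :> C.
Proof.
rewrite /theta0; congr (if _ then _ else _); apply: eq_forallb => i.
by rewrite /latpt addrAC rpredDr// dvdz_mulr.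
Qed.

Lemma Ispace_periodic (b : ('I_l -> int) -> C) mu p : Ispace k delta b ->
  b (latpt k delta mu p) = b mu.
Proof.
by move=> [s ->]; apply: eq_bigr => x _; rewrite theta0_periodic.
Qed.

Lemma Ispace_bounded (b : ('I_l -> int) -> C) : Ispace k delta b ->
  exists M : R, forall mu, `|b mu| <= M%:C.
Proof.
move=> [s ->]; exists (\sum_(x <- s) complex.Re `|x.2|) => mu.
rewrite (le_trans (ler_norm_sum _ _ _))// rmorph_sum ler_sum//= => x _.
rewrite normrM theta0E (_ : (complex.Re `|x.2|)%:C = `|x.2|); last by rewrite normc_def.
by case: (_ == _); rewrite ?normr1 ?normr0 ?mulr1 ?mulr0.
Qed.

Variable Om : 'M[C]_l.
Hypotheses (Om_sym : Om^T = Om) (Om2_pd : posdef (Omega2 Om)).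

Lemma hsum_thterm (b : ('I_l -> int) -> C) (M : R) z : (forall mu, `|b mu| <= M%:C) ->
  exists s, hsum (fun mu => b mu * thterm k Om mu z) s.
Proof.
move=> bM; have M0 : 0 <= M by rewrite -ler0c (le_trans _ (bM (fun=> 0%R)))// normr_ge0.
have [c hc] := thterm_bound (\sum_i `|complex.Im (z i)|) k_gt0 Om_sym Om2_pd.
apply: (@hsumC_geomw _ _ _ (M * c)) => mu.
rewrite normrM -mulrA rmorphM ler_pM// hc// => i.
by rewrite (bigD1 i)//= lerDl sumr_ge0.
Qed.

Lemma CabE b z s : hsum (fun mu => b mu * thterm k Om mu z) s -> Cab Om (k%:R)^-1 b z = s.
Proof.
move=> h; apply: zsumE; move: h; congr (hsum _ _); apply/funext => mu.
by rewrite -mulrA /thterm cexpD fmorphV /= rmorph_nat.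
Qed.

Lemma thetaE m z s : hsum (fun mu => theta0 k delta m mu * thterm k Om mu z) s ->
  theta k delta Om m z = s.
Proof. by move=> /hsum_theta0 h; exact: zsumE. Qed.

(** Linearity on finite combinations. Since the same list describes an element of either span, both
    inclusions between image and theta space follow. *)
Lemma Cab_theta0_sum (s : seq (('I_l -> int) * C)) :
  Cab Om (k%:R)^-1 (fun mu => \sum_(x <- s) x.2 * theta0 k delta x.1 mu) =
  fun z => \sum_(x <- s) x.2 * theta k delta Om x.1 z.
Proof.
apply/funext => z; apply: CabE.
rewrite [X in hsum X](_ : _ = fun mu => \sum_(x <- s)
    x.2 * (theta0 k delta x.1 mu * thterm k Om mu z)).
  apply: hsum_sum => x _; apply: hsumZ.
  have [|t ht] := @hsum_thterm (theta0 k delta x.1) 1 z.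
    by move=> mu; rewrite theta0E; case: (_ == _); rewrite ?normr1 ?normr0 ?lexx ?ler01.
  by rewrite (thetaE ht).
by apply/funext => mu; rewrite mulr_suml; apply: eq_bigr => x _; rewrite mulrA.
Qed.

Lemma Cab_theta0 m : Cab Om (k%:R)^-1 (theta0 k delta m) = theta k delta Om m.
Proof.
have := Cab_theta0_sum [:: (m, 1)].
have -> : (fun mu => \sum_(x <- [:: (m, 1)]) x.2 * theta0 k delta x.1 mu) =
    theta0 k delta m :> (_ -> C).
  by apply/funext => mu; rewrite big_seq1 mul1r.
by move=> ->; apply/funext => z; rewrite big_seq1 mul1r.
Qed.

End LatticeClasses.

(** * Quasi-periodicity of the hermitian weight *)

Section Nu.
Variables (R : realType) (l k : nat) (Om : 'M[R[i]]_l).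
Hypotheses (k_gt0 : (0 < k)%N) (Om_sym : Om^T = Om) (Y_unit : Omega2 Om \in unitmx).
Local Notation C := R[i].
Local Notation Y := (Omega2 Om).
Implicit Types z : 'I_l -> C.

Let imv z : 'cV[R]_l := \col_i complex.Im (z i).

(** As z - conj z is 2 i Im z, the form acquires the factor -4, which meets pi k / 2 to give - 2 pi
    k. *)
Lemma nuE z : nu Om (k%:R)^-1 z =
  ((2 / (k%:R)^-1) `^ (l%:R / 2))%:C * ((\det Y) `^ (- (1 / 2)))%:C *
  (expR (- (2 * pi * k%:R * qf (invmx Y) (imv z))))%:C.
Proof.
rewrite /nu -cexp_realC; congr (_ * cexp _).
have zE i : z i - (z i)^* = 'i * (2 * imv z i 0)%:C.
  by rewrite mxE (subcJ (z i)) -complexiE rmorphM /= rmorph_nat; ring.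
have -> : \sum_(i < l) \sum_(j < l) (z i - (z i)^*) * (invmx Y i j)%:C * (z j - (z j)^*) =
    (- 4 * qf (invmx Y) (imv z))%:C.
  rewrite qfE mulr_sumr rmorph_sum; apply: eq_bigr => i _.
  rewrite mulr_sumr rmorph_sum; apply: eq_bigr => j _; rewrite !zE.
  set a := imv z i 0; set b := imv z j 0; set c := invmx Y i j.
  have -> : 'i * (2 * a)%:C * c%:C * ('i * (2 * b)%:C) = 'i ^+ 2 * (2 * a * c * (2 * b))%:C.
    by rewrite !rmorphM /=; ring.
  by rewrite sqrCi mulN1r -rmorphN; congr (_%:C); ring.
rewrite -fmorphV -!rmorphM; congr (_%:C); field.
by rewrite pnatr_eq0 -lt0n.
Qed.

Lemma nu_shift_evec z j : nu Om (k%:R)^-1 (fun i => z i + evec j i) = nu Om (k%:R)^-1 z.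
Proof.
rewrite !nuE (_ : imv _ = imv z)//; apply/matrixP => i ?.
by rewrite !mxE Im_addc /evec natC /= addr0.
Qed.

(** The shift is a multiple of [Y e_j], so [invmx Y] cancels in the cross terms and in the
    square. *)
Lemma qf_invmx_shift (y : 'cV[R]_l) j (n : R) :
  qf (invmx Y) (y + n *: (Y *m delta_mx j 0)) =
  qf (invmx Y) y + 2 * n * y j 0 + n ^+ 2 * Y j j.
Proof.
set e : 'cV[R]_l := delta_mx j 0; set v := n *: _.
have Mv : invmx Y *m v = n *: e by rewrite -scalemxAr mulKmx.
have vM : v^T *m invmx Y = n *: e^T.
  rewrite /v [(n *: _)^T]linearZ /= trmx_mul Omega2_sym//.
  by rewrite -scalemxAl -mulmxA mulmxV ?mulmx1.
have ye : (y^T *m e) 0 0 = y j 0 by rewrite -colE !mxE.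
have ey : (e^T *m y) 0 0 = y j 0 by rewrite trmx_delta -rowE !mxE.
have ev : (e^T *m v) 0 0 = n * Y j j.
  by rewrite trmx_delta -rowE mxE /v mxE -colE mxE.
clearbody v; rewrite /qf [(y + v)^T]linearD /= mulmxDr !mulmxDl vM -[y^T *m _ *m v]mulmxA Mv.
have D (P Q : 'M[R]_1) : (P + Q) 0 0 = P 0 0 + Q 0 0 by rewrite mxE.
have Z a (P : 'M[R]_1) : (a *: P) 0 0 = a * P 0 0 by rewrite mxE.
by rewrite -!scalemxAr -!scalemxAl !D !Z ey ye ev; ring.
Qed.

Lemma nu_shift_Omega z j (n : nat) :
  nu Om (k%:R)^-1 (fun i => z i + Om i j * n%:R)
  = `| cexp (- (2%:R * pi%:C * 'i * k%:R * z j * n%:R)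
             - pi%:C * 'i * k%:R * Om j j * (n%:R ^+ 2)) | ^- 2 * nu Om (k%:R)^-1 z.
Proof.
rewrite !nuE mulrCA; congr (_ * _).
have -> : - (2%:R * pi%:C * 'i * k%:R * z j * n%:R) - pi%:C * 'i * k%:R * Om j j * (n%:R ^+ 2)
    = (2 * pi * k%:R * n%:R)%:C * ('i * - z j) + (pi * k%:R * n%:R ^+ 2)%:C * ('i * - Om j j).
  by rewrite !natC !rmorphM /=; ring.
have ImN (w : C) : complex.Im (- w) = - complex.Im w by case: w.
rewrite normC_cexp -!rmorphXn -fmorphV -rmorphM; congr (_%:C).
rewrite expr2 -expRD -expRN -expRD; congr expR.
rewrite Re_addc !Re_realM !Re_iM !ImN !opprK.
(* The translation moves the imaginary part by n times the j-th column of [Y]. *)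
have -> : imv (fun i => z i + Om i j * n%:R) = imv z + n%:R *: (Y *m delta_mx j 0).
  apply/matrixP => i o; rewrite ord1 -colE !mxE Im_addc natC [Om i j * _]mulrC Im_realM.
  by [].
by rewrite qf_invmx_shift !mxE; ring.
Qed.

End Nu.
(** * Unitarity *)

Section InnerProduct.
Variables (R : realType) (l k : nat) (delta : 'I_l -> nat) (Om : 'M[R[i]]_l).
Hypotheses (k_gt0 : (0 < k)%N) (delta_gt0 : forall i, (0 < delta i)%N).
Hypotheses (Om_sym : Om^T = Om) (Om2_pd : posdef (Omega2 Om)).
Local Notation C := R[i].
Local Notation Y := (Omega2 Om).
Implicit Types (mu nu p : 'I_l -> int) (b : ('I_l -> int) -> C).

Definition wpt (eta xi : 'I_l -> R) (i : 'I_l) : C :=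
  (eta i)%:C + \sum_(j < l) Om i j * (delta j)%:R * (xi j)%:C.

Definition wcst : R :=
  (2 * k%:R) `^ (l%:R / 2) * (\det Y) `^ (1 / 2) * (\prod_(i < l) delta i)%:R.

Definition wgt (xi : 'I_l -> R) : R :=
  wcst * expR (- (2 * pi * k%:R) *
    \sum_(i < l) \sum_(j < l) (delta i)%:R * xi i * Y i j * ((delta j)%:R * xi j)).

(** One list of length l + l: the first half holds eta, the second xi, so both integrals merge into
    a single one. *)
Definition boxpt (s : seq R) : 'I_l -> C :=
  wpt (fun i => s`_i) (fun i => s`_(l + i)).

Lemma ipHE f g : ipH k delta Om f g =
  cboxint (l + l) (fun s => (f (boxpt s))^* * g (boxpt s) * (wgt (fun i => s`_(l + i)))%:C).
Proof.
rewrite cboxint_cat; set G := fun se sx => ipH_integrand k delta Om f g se sx.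
transitivity (cboxint l (fun se => cboxint l (fun sx => G se sx))).
  rewrite /ipH {1}/cboxint; congr (_%:C + _ * _%:C); apply: eq_boxint => s _.
    by rewrite Re_cboxint.
  by rewrite Im_cboxint.
apply: eq_cboxint => s /andP[/eqP ss _]; apply: eq_cboxint => t _.
have h1 (i : 'I_l) : (s ++ t)`_i = s`_i by rewrite nth_cat ss ltn_ord.
have h2 (i : 'I_l) : (s ++ t)`_(l + i) = t`_i by rewrite nth_cat ss ltnNge leq_addr addKn.
have e1 : (fun i : 'I_l => (s ++ t)`_i) = (fun i : 'I_l => s`_i) by apply/funext.
have e2 : (fun i : 'I_l => (s ++ t)`_(l + i)) = (fun i : 'I_l => t`_i) by apply/funext.
by rewrite /boxpt e1 e2.
Qed.

Lemma cUC_wpt n (eta xi : seq R -> 'I_l -> R) i :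
  (forall i, UC n (fun s => eta s i)) -> (forall i, UC n (fun s => xi s i)) ->
  cUC n (fun s => wpt (eta s) (xi s) i).
Proof.
move=> h1 h2; apply: cUCD; first exact: cUC_realC.
by apply: cUC_sum => j _; apply: cUCM; [exact: cUC_cst|exact: cUC_realC].
Qed.

Lemma cUC_thterm n (z : seq R -> 'I_l -> C) mu : (forall i, cUC n (fun s => z s i)) ->
  cUC n (fun s => thterm k Om mu (z s)).
Proof.
move=> hz; apply: cUC_cexp; apply: cUCD; first exact: cUC_cst.
apply: cUCM; first exact: cUC_cst.
by apply: cUC_sum => i _; apply: cUCM; [exact: cUC_cst|exact: hz].
Qed.

Lemma UC_wgt n (xi : seq R -> 'I_l -> R) : (forall i, UC n (fun s => xi s i)) ->
  UC n (fun s => wgt (xi s)).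
Proof.
move=> h; apply: UCM; first exact: UC_cst.
apply: UC_expR; apply: UCM; first exact: UC_cst.
have h' i : UC n (fun s => (delta i)%:R * xi s i) by apply: UCM => //; exact: UC_cst.
apply: UC_sum => i _; apply: UC_sum => j _; apply: UCM => //.
by apply: UCM => //; exact: UC_cst.
Qed.

(** Kept as a product over coordinates so that its integral splits into one-variable integrals. *)
Let chr mu (eta : 'I_l -> R) : C :=
  \prod_(i < l) cexp (2%:R * pi%:C * 'i * ((mu i)%:~R * (eta i)%:C)).

Lemma thterm_wpt mu eta xi :
  thterm k Om mu (wpt eta xi) = chr mu eta * thterm k Om mu (wpt (fun=> 0) xi).
Proof.
rewrite /chr -cexp_sum -cexpD; congr cexp; rewrite addrCA; congr (_ + _).
rewrite -mulr_sumr -mulrDr -big_split /=; congr (_ * _); apply: eq_bigr => i _.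
by rewrite /wpt add0r mulrDr.
Qed.

Lemma chr_conjM mu nu eta : (chr mu eta)^* * chr nu eta = chr (fun i => nu i - mu i) eta.
Proof.
rewrite /chr rmorph_prod -big_split /=; apply: eq_bigr => i _.
rewrite cexp_conj -cexpD; congr cexp.
rewrite !rmorphM /= conjCi rmorph_nat rmorph_int /=.
have cr (x : R) : (x%:C)^* = x%:C by rewrite -[RHS]conjc_real.
by rewrite !cr rmorphB /=; ring.
Qed.

Lemma cboxint_chr mu : cboxint l (fun s => chr mu (fun i => s`_i)) = [forall i, mu i == 0]%:R.
Proof.
rewrite (cboxint_prod (f := fun (i : 'I_l) x => cexp (2%:R * pi%:C * 'i * ((mu i)%:~R * x%:C)))).
  under eq_bigr do rewrite cboxint_char.
  case: forallP => [H|/forallP]; first by rewrite big1// => i _; rewrite H.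
  rewrite negb_forall => /existsP[i /negbTE mi].
  by rewrite (bigD1 i)//= mi mul0r.
move=> i m j; apply: cUC_cexp; apply: cUCM; first exact: cUC_cst.
by apply: cUCM; [exact: cUC_cst|apply: cUC_realC; exact: UC_nth].
Qed.

(** The number h_mu of the overview, with [wcst] for its constant c. *)
Definition gaussH mu : R := boxint l (fun s => wcst *
  expR (- (2 * pi * k%:R * qf Y (\col_i ((delta i)%:R * s`_i) + k%:R^-1 *: ivec R mu)))).

Lemma qfD (a c : 'cV[R]_l) (t : R) :
  qf Y (a + t *: c) = qf Y a + 2 * t * (\sum_i c i 0 * (Y *m a) i 0) + t ^+ 2 * qf Y c.
Proof.
have D (P Q : 'M[R]_1) : (P + Q) 0 0 = P 0 0 + Q 0 0 by rewrite mxE.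
have Z u (P : 'M[R]_1) : (u *: P) 0 0 = u * P 0 0 by rewrite mxE.
have E1 : (c^T *m Y *m a) 0 0 = \sum_i c i 0 * (Y *m a) i 0.
  by rewrite -mulmxA mxE; apply: eq_bigr => i _; rewrite mxE.
have E2 : (a^T *m Y *m c) 0 0 = (c^T *m Y *m a) 0 0.
  have -> : c^T *m Y *m a = (a^T *m Y *m c)^T.
    by rewrite !trmx_mul trmxK (Omega2_sym Om_sym) mulmxA.
  by rewrite [RHS]mxE.
rewrite /qf [(a + t *: c)^T]linearD /= [(t *: c)^T]linearZ /= mulmxDr !mulmxDl.
rewrite -!scalemxAl -!scalemxAr !D !Z. by rewrite E2 E1; ring.
Qed.

(** The squared modulus contributes - 2 pi q(mu) / k - 4 pi mu.Y(delta xi), exactly what completes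
    the square of the weight's exponent - 2 pi k q(delta xi). *)
Lemma thterm_normsq mu xi :
  (thterm k Om mu (wpt (fun=> 0) xi))^* * thterm k Om mu (wpt (fun=> 0) xi) * (wgt xi)%:C =
  (wcst * expR (- (2 * pi * k%:R *
     qf Y (\col_i ((delta i)%:R * xi i) + k%:R^-1 *: ivec R mu))))%:C.
Proof.
have kR : k%:R != 0 :> R by rewrite pnatr_eq0 -lt0n.
rewrite mulrC [_^* * _]mulrC -normCK normC_thterm -rmorphXn -rmorphM; congr (_%:C).
rewrite /wgt expr2 -[LHS]mulrA -!expRD; congr (_ * expR _).
have qE : qf Y (\col_i ((delta i)%:R * xi i)) =
    \sum_(i < l) \sum_(j < l) (delta i)%:R * xi i * Y i j * ((delta j)%:R * xi j).
  by rewrite qfE; apply: eq_bigr => i _; apply: eq_bigr => j _; rewrite !mxE.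
rewrite qfD qE.
have -> : \sum_i (mu i)%:~R * complex.Im (wpt (fun=> 0) xi i) =
    \sum_i ivec R mu i 0 * (Y *m (\col_i ((delta i)%:R * xi i))) i 0.
  apply: eq_bigr => i _; rewrite !mxE; congr (_ * _).
  rewrite /wpt add0r Im_sum; apply: eq_bigr => j _.
  by rewrite natC [_ * (xi j)%:C]mulrC Im_realM [Om i j * _]mulrC Im_realM !mxE; ring.
by field.
Qed.

(** eta enters only through the character of frequency nu - mu, so the integral is that of the
    character times an integral over xi, which is evaluated only on the diagonal. *)
Lemma cboxint_thterm mu nu :
  cboxint (l + l) (fun s => (thterm k Om mu (boxpt s))^* * thterm k Om nu (boxpt s) *
    (wgt (fun i => s`_(l + i)))%:C) = (mu == nu)%:R * (gaussH mu)%:C.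
Proof.
pose B xi : C := (thterm k Om mu (wpt (fun=> 0) xi))^* *
  thterm k Om nu (wpt (fun=> 0) xi) * (wgt xi)%:C.
have UCB : cUC l (fun s => B (fun i => s`_i)).
  have hw i : cUC l (fun s => wpt (fun=> 0) (fun i => s`_i) i).
    by apply: cUC_wpt => j; [exact: UC_cst|exact: UC_nth].
  apply: cUCM; last by apply/cUC_realC/UC_wgt => i; exact: UC_nth.
  by apply: cUCM; [apply: cUC_conj|]; exact: cUC_thterm.
have UCc m : cUC l (fun s => chr m (fun i => s`_i)).
  apply: cUC_prod => i _; apply: cUC_cexp; apply: cUCM; first exact: cUC_cst.
  by apply: cUCM; [exact: cUC_cst|apply: cUC_realC; exact: UC_nth].
transitivity (cboxint l (fun s => chr (fun i => nu i - mu i) (fun i => s`_i)) *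
    cboxint l (fun s => B (fun i => s`_i))).
  rewrite -cboxintM// cboxint_cat.
  apply: eq_cboxint => s /andP[/eqP ss _]; apply: eq_cboxint => t _.
  have h1 (i : 'I_l) : (s ++ t)`_i = s`_i by rewrite nth_cat ss ltn_ord.
  have h2 (i : 'I_l) : (s ++ t)`_(l + i) = t`_i by rewrite nth_cat ss ltnNge leq_addr addKn.
  have e1 : (fun i : 'I_l => (s ++ t)`_i) = (fun i : 'I_l => s`_i) by apply/funext.
  have e2 : (fun i : 'I_l => (s ++ t)`_(l + i)) = (fun i : 'I_l => t`_i) by apply/funext.
  rewrite /boxpt e1 e2 (thterm_wpt mu) (thterm_wpt nu) rmorphM /= -chr_conjM /B.
  set x := thterm _ _ _ _; set y := thterm _ _ _ _; set x' := chr _ _; set y' := chr _ _.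
  by ring.
rewrite cboxint_chr.
have -> : [forall i, nu i - mu i == 0] = (mu == nu).
  apply/forallP/eqP => [H|-> i]; last by rewrite subrr.
  by apply/funext => i; apply/esym/eqP; rewrite -subr_eq0.
case: eqP => [mn|_]; last by rewrite !mul0r.
rewrite !mul1r /B -mn /gaussH -cboxint_realC; apply: eq_cboxint => s _.
exact: thterm_normsq.
Qed.

End InnerProduct.

(** * Total mass of a frequency class, and the isometry *)

Section Unitarity.
Variables (R : realType) (l k : nat) (delta : 'I_l -> nat) (Om : 'M[R[i]]_l).
Hypotheses (k_gt0 : (0 < k)%N) (delta_gt0 : forall i, (0 < delta i)%N).
Hypotheses (Om_sym : Om^T = Om) (Om2_pd : posdef (Omega2 Om)).
Local Notation C := R[i].
Local Notation Y := (Omega2 Om).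
Implicit Types (mu nu p : 'I_l -> int) (b : ('I_l -> int) -> C).

Let kR : 0 < k%:R :> R. Proof. by rewrite ltr0n. Qed.
Let Ysym : Y^T = Y. Proof. exact: Omega2_sym. Qed.
Let detY : 0 < \det Y. Proof. by have [] := gaussbox_cvg Ysym Om2_pd. Qed.

Let D : 'M[R]_l := diag_mx (\row_i (delta i)%:R).
(** The Gaussian exponent in the coordinates xi, where delta is absorbed into the matrix and a step
    of p in the class becomes an integer translation. *)
Let A : 'M[R]_l := (2 * pi * k%:R) *: (D *m Y *m D).

Let qfA v : qf A v = 2 * pi * k%:R * qf Y (D *m v).
Proof.
by rewrite /qf /A -scalemxAr -scalemxAl mxE trmx_mul tr_diag_mx !mulmxA.
Qed.

Let Asym : A^T = A.
Proof. by rewrite /A linearZ /= !trmx_mul Ysym !tr_diag_mx mulmxA. Qed.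

Let Apd : posdef A.
Proof.
move=> v v0; rewrite qfA !mulr_gt0 ?pi_gt0//; apply: Om2_pd.
apply: contra v0 => /eqP Dv0; apply/eqP/matrixP => i j; rewrite ord1 [RHS]mxE.
have := congr1 (fun M : 'cV_l => M i 0) Dv0; rewrite mul_diag_mx !mxE => /eqP.
by rewrite mulf_eq0 pnatr_eq0 gtn_eqF//= => /eqP.
Qed.

Let prod_delta_gt0 : 0 < (\prod_(i < l) delta i)%:R :> R.
Proof. by rewrite ltr0n prodn_gt0. Qed.

Let detA : \det A = (2 * pi * k%:R) ^+ l * (\prod_(i < l) delta i)%:R ^+ 2 * \det Y.
Proof.
rewrite /A detZ !det_mulmx det_diag.
rewrite (eq_bigr (fun i => (delta i)%:R)) => [|i _]; last by rewrite mxE.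
by rewrite natr_prod; ring.
Qed.

(** [pi ^+ l / \det A] is 1 / ((2 k)^l (prod delta)^2 det Y), the inverse square of [wcst]. Both
    factors are nonnegative, so comparing squares avoids handling the half-integral powers. *)
Lemma wcst_gaussconst : wcst k delta Om * gaussconst A = 1.
Proof.
have a0 : 0 < 2 * k%:R :> R by rewrite mulr_gt0.
have w0 : 0 <= wcst k delta Om by rewrite !mulr_ge0 ?powR_ge0.
have wg0 : 0 <= wcst k delta Om * gaussconst A by apply: mulr_ge0 => //; exact: sqrtr_ge0.
apply/eqP; rewrite -(@eqrXn2 _ 2)//; apply/eqP.
have pi0 : 0 < pi :> R by exact: pi_gt0.
rewrite expr1n exprMn sqr_sqrtr; last first.
  by rewrite divr_ge0 ?exprn_ge0 ?ltW// detA !mulr_gt0 ?exprn_gt0 ?mulr_gt0.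
have p1 : ((2 * k%:R) `^ (l%:R / 2)) ^+ 2 = (2 * k%:R) ^+ l :> R.
  by rewrite -powR_mulrn ?powR_ge0// -powRrM divfK ?pnatr_eq0// powR_mulrn// ltW.
have p2 : (\det Y `^ (1 / 2)) ^+ 2 = \det Y.
  by rewrite -powR_mulrn ?powR_ge0// -powRrM divfK ?pnatr_eq0// powRr1// ltW.
rewrite /wcst !exprMn p1 p2 detA !exprMn; field.
by rewrite !gt_eqF ?exprn_gt0.
Qed.

Lemma gaussH_ge0 mu : 0 <= gaussH k delta Om mu.
Proof.
apply: boxint_ge0 => s _; rewrite mulr_ge0 ?expR_ge0//.
by rewrite !mulr_ge0 ?powR_ge0.
Qed.

(** Because delta s + (m + k delta p) / k = delta (s + p + m / (k delta)), the class representative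
    only shifts the tiling. *)
Lemma gaussH_latpt m p : gaussH k delta Om (latpt k delta m p) =
  wcst k delta Om * boxint l (fun s => expR (- qf A (colv l s +
    (ivec R p + \col_i ((m i)%:~R / (k%:R * (delta i)%:R)))))).
Proof.
rewrite -boxintZ; last exact: UC_gauss.
apply: eq_boxint => s _; rewrite qfA; congr (_ * expR (- (_ * qf _ _))).
apply/matrixP => i j; rewrite ord1 mul_diag_mx !mxE /latpt rmorphD rmorphM /= -pmulrn natrM.
field.
by rewrite !pnatr_eq0 -!lt0n k_gt0 delta_gt0.
Qed.

(** Over a box the masses add up to [wcst] times a [gaussbox] with the fixed shift m / (k delta);
    both estimates of [gaussbox_cvg] apply, and the normalization gives 1. *)
Lemma hsum_gaussH m : hsum (fun p => gaussH k delta Om (latpt k delta m p)) 1.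
Proof.
have w0 : 0 < wcst k delta Om.
  rewrite !mulr_gt0 ?powR_gt0 ?mulr_gt0//.
pose a : 'cV[R]_l := \col_i ((m i)%:~R / (k%:R * (delta i)%:R)).
have E N : \sum_(p <- boxset l N) gaussH k delta Om (latpt k delta m p) =
    wcst k delta Om * gaussbox A N a.
  by rewrite mulr_sumr; apply: eq_bigr => p _; exact: gaussH_latpt.
have [_ hle hge] := gaussbox_cvg Asym Apd.
apply: hsum_nneg_boxset => [p|N|e e0]; first exact: gaussH_ge0.
  by rewrite E; have := ler_wpM2l (ltW w0) (hle N a); rewrite wcst_gaussconst.
have [N0 /(_ _ (leqnn N0)) h] := hge (e / wcst k delta Om) (\sum_i `|a i 0|) (divr_gt0 e0 w0).
exists N0; rewrite E.
have -> : 1 - e = wcst k delta Om * (gaussconst A - e / wcst k delta Om).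
  by rewrite mulrBr wcst_gaussconst mulrCA divff ?gt_eqF// mulr1.
apply: ler_wpM2l; [exact: ltW|apply: h => i].
by rewrite (bigD1 i)//= lerDl sumr_ge0.
Qed.

Let fund (q : {ffun 'I_l -> 'I_(k * dmax delta)}) := [forall i, (q i < k * delta i)%N].
Let qz (q : {ffun 'I_l -> 'I_(k * dmax delta)}) : 'I_l -> int := fun i => (q i)%:Z.

(** The classes of the fundamental domain partition Z^l: the only contributing [q] is the vector of
    residues of [mu] modulo k delta_i. *)
Lemma sum_theta0_fund mu : \sum_(q | fund q) theta0 k delta (qz q) mu = 1 :> C.
Proof.
have kd i : (0 < k * delta i)%N by rewrite muln_gt0 k_gt0 delta_gt0.
have kdz i : (k * delta i)%:Z != 0 by rewrite eqz_nat -lt0n.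
have rb i : (absz (mu i %% (k * delta i)%:Z)%Z < k * delta i)%N.
  by rewrite -ltz_nat gez0_abs ?modz_ge0// ltz_pmod// ltz_nat.
have rb' i : (absz (mu i %% (k * delta i)%:Z)%Z < k * dmax delta)%N.
  by rewrite (leq_trans (rb i))// leq_mul2l (leq_bigmax i) orbT.
pose q0 : {ffun 'I_l -> 'I_(k * dmax delta)} := [ffun i => Ordinal (rb' i)].
have q0E i : (q0 i)%:Z = (mu i %% (k * delta i)%:Z)%Z.
  by rewrite ffunE /= gez0_abs// modz_ge0.
have fq0 : fund q0 by apply/forallP => i; rewrite ffunE /=.
rewrite (bigD1 q0)//= big1 ?addr0 => [|q /andP[/forallP fq qq0]].
  rewrite /theta0 (_ : [forall i, _]) //; apply/forallP => i.
  by rewrite /qz q0E {1}(divz_eq (mu i) (k * delta i)%:Z) addrK dvdz_mull.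
rewrite /theta0; case: forallP => // H; case/eqP: qq0; apply/ffunP => i; apply/val_inj.
apply/eqP; rewrite -eqz_nat q0E -[X in X == _](@modz_small _ (k * delta i)%:Z).
  by rewrite eq_sym eqz_mod_dvd.
by rewrite lez_nat ltz_nat leq0n fq.
Qed.

(** Split by classes: [b] and [b'] are constant on each, and each class has total mass 1, which
    leaves the finite sum [ipI]. *)
Lemma hsum_fund b b' : Ispace k delta b -> Ispace k delta b' ->
  hsum (fun mu => (b mu)^* * b' mu * (gaussH k delta Om mu)%:C) (ipI k delta b b').
Proof.
move=> hb hb'.
rewrite [X in hsum X](_ : _ = fun mu => \sum_(q | fund q) theta0 k delta (qz q) mu *
    ((b mu)^* * b' mu * (gaussH k delta Om mu)%:C)); last first.
  by apply/funext => mu; rewrite -mulr_suml sum_theta0_fund mul1r.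
apply: hsum_sum => q _; apply/(hsum_theta0 k_gt0 delta_gt0).
have := hsumZ ((b (qz q))^* * b' (qz q)) (hsum_realC (hsum_gaussH (qz q))).
rewrite rmorph1 mulr1; congr (hsum _ _); apply/funext => p.
by rewrite (Ispace_periodic _ _ hb) (Ispace_periodic _ _ hb').
Qed.

(* The hypotheses say that [b - b'] is orthogonal to [b] and to [b'], hence to itself. *)
Lemma ipI_separated b b' : Ispace k delta b -> Ispace k delta b' ->
  ipI k delta b b = ipI k delta b b' -> ipI k delta b' b = ipI k delta b' b' -> b = b'.
Proof.
move=> hb hb' e1 e2.
have /psumr_eq0P H : \sum_(q | fund q) `|b (qz q) - b' (qz q)| ^+ 2 = 0.
  transitivity (ipI k delta b b - ipI k delta b b' - (ipI k delta b' b - ipI k delta b' b')).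
    rewrite /ipI -!sumrB; apply: eq_bigr => q _.
    by rewrite normCKC rmorphB /= /qz; ring.
  by rewrite e1 e2 !subrr.
have {}H q : fund q -> b (qz q) = b' (qz q).
  move=> fq; apply/eqP; rewrite -subr_eq0 -normr_eq0 -sqrf_eq0.
  by rewrite H// => ? _; rewrite exprn_ge0.
apply/funext => mu; apply: contrapT => bb'.
have /eqP := sum_theta0_fund mu; rewrite big1 ?(eq_sym 0) ?oner_eq0// => q fq.
rewrite theta0E; case: eqP => // e; case: bb'.
by rewrite -e (Ispace_periodic _ _ hb) (Ispace_periodic _ _ hb') H.
Qed.

Lemma hsum_norm_le (T : ('I_l -> int) -> C) (s : C) (M : R) : hsum T s -> 0 <= M ->
  (forall mu, `|T mu| <= (M * geomw R mu)%:C) -> `|s| <= (M * 3 ^+ l)%:C.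
Proof.
move=> hT M0 TM.
have := @hsum_tail _ _ T (fun mu => (M * geomw R mu)%:C) s (M * 3 ^+ l)%:C fset0 hT _ TM.
rewrite !big_seq_fset0 subr0 sub0r normrN; apply => B.
by rewrite -rmorph_sum lecR -mulr_sumr ler_wpM2l// sum_geomw_le.
Qed.

(** Im z = Y delta xi stays bounded on the cell, so one majorant serves all points of the
    integration domain. *)
Lemma boxpt_Im_le s i : inbox (l + l) s ->
  `|complex.Im (boxpt delta Om s i)| <= \sum_i \sum_j `|Y i j| * (delta j)%:R.
Proof.
move=> sb; rewrite (bigD1 i)//= -[leLHS]addr0 lerD//; last first.
  by apply: sumr_ge0 => j _; apply: sumr_ge0 => h _; rewrite mulr_ge0.
rewrite /boxpt /wpt Im_addc /= add0r Im_sum (le_trans (ler_norm_sum _ _ _))// ler_sum// => j _.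
rewrite natC [_ * (s`_ _)%:C]mulrC Im_realM [Om i j * _]mulrC Im_realM mxE.
have /andP[s0 s1] := inbox_nth (l + j) sb.
by rewrite !normrM (ger0_norm s0) normr_nat [leRHS]mulrC ler_piMl// mulr_ge0.
Qed.

(** Both series are cut to the same box. The truncated integrand integrates to a box sum of the
    family in [hsum_fund], and it converges uniformly on the cell to the full one, so the integrals
    converge too. *)
Lemma ipH_Cab b b' : Ispace k delta b -> Ispace k delta b' ->
  ipH k delta Om (Cab Om (k%:R)^-1 b) (Cab Om (k%:R)^-1 b') = ipI k delta b b'.
Proof.
move=> hb hb'.
have [M1 bM1] := Ispace_bounded hb.
have [M2 bM2] := Ispace_bounded hb'.
pose M := `|M1| + `|M2|; have M0 : 0 <= M by rewrite addr_ge0.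
have bM mu : `|b mu| <= M%:C.
  by rewrite (le_trans (bM1 mu))// lecR (le_trans (ler_norm _))// lerDl.
have bM' mu : `|b' mu| <= M%:C.
  by rewrite (le_trans (bM2 mu))// lecR (le_trans (ler_norm _))// lerDr.
have [c0 hc0] := thterm_bound (\sum_i \sum_j `|Y i j| * (delta j)%:R) k_gt0 Om_sym Om2_pd.
pose c := M * `|c0|; have c_ge0 : 0 <= c by rewrite mulr_ge0.
pose P := inbox (R := R) (l + l).
have term_le (a : ('I_l -> int) -> C) s mu : (forall mu, `|a mu| <= M%:C) -> P s ->
    `|a mu * thterm k Om mu (boxpt delta Om s)| <= (c * geomw R mu)%:C.
  move=> aM sb; rewrite normrM /c -mulrA rmorphM ler_pM//.
  rewrite (le_trans (hc0 _ (fun i => boxpt_Im_le i sb) mu))// lecR ler_wpM2r ?geomw_ge0//.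
  exact: ler_norm.
have Cab_hsum (a : ('I_l -> int) -> C) s : (forall mu, `|a mu| <= M%:C) ->
    hsum (fun mu => a mu * thterm k Om mu (boxpt delta Om s))
      (Cab Om (k%:R)^-1 a (boxpt delta Om s)).
  move=> aM; have [t ht] := hsum_thterm k_gt0 Om_sym Om2_pd (boxpt delta Om s) aM.
  by rewrite (CabE ht).
pose K := c * 3 ^+ l; have K0 : 0 <= K by rewrite mulr_ge0// exprn_ge0.
have Cab_le (a : ('I_l -> int) -> C) s : (forall mu, `|a mu| <= M%:C) -> P s ->
    `|Cab Om (k%:R)^-1 a (boxpt delta Om s)| <= K%:C.
  by move=> aM sb; apply: (hsum_norm_le (Cab_hsum a s aM)) => // mu; exact: term_le.
pose fN (a : ('I_l -> int) -> C) N s :=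
  \sum_(mu <- boxset l N) a mu * thterm k Om mu (boxpt delta Om s).
have fN_le (a : ('I_l -> int) -> C) N s : (forall mu, `|a mu| <= M%:C) -> P s ->
    `|fN a N s| <= K%:C.
  move=> aM sb; rewrite (le_trans (ler_norm_sum _ _ _))//.
  apply: (@le_trans _ _ (\sum_(mu <- boxset l N) (c * geomw R mu)%:C)).
    by apply: ler_sum => mu _; exact: term_le.
  by rewrite -rmorph_sum lecR -mulr_sumr ler_wpM2l// sum_geomw_le.
have fN_cvg (a : ('I_l -> int) -> C) : (forall mu, `|a mu| <= M%:C) ->
    forall e : R, 0 < e -> exists N0, forall N, (N0 <= N)%N -> forall s, P s ->
    `|fN a N s - Cab Om (k%:R)^-1 a (boxpt delta Om s)| <= e%:C.
  move=> aM; apply: (@hsum_geomw_unif R l (seq R) P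
    (fun s mu => a mu * thterm k Om mu (boxpt delta Om s)) _ c).
    by move=> s _; exact: Cab_hsum.
  by move=> s mu sb; exact: term_le.
pose W (s : seq R) : R := wgt k delta Om (fun i => s`_(l + i)).
have UCW : UC (l + l) W by apply: UC_wgt => i; exact: UC_nth.
have [V hV] := UC_bounded UCW.
have V0 : 0 <= V.
  apply: le_trans (normr_ge0 _) (hV (nseq (l + l) 0) _).
  by rewrite /inbox size_nseq eqxx; apply/allP => x /nseqP[-> _]; rewrite lexx ler01.
pose F s : C := (Cab Om (k%:R)^-1 b (boxpt delta Om s))^* *
  Cab Om (k%:R)^-1 b' (boxpt delta Om s) * (W s)%:C.
pose FN N s : C := (fN b N s)^* * fN b' N s * (W s)%:C.
have UCth mu : cUC (l + l) (fun s => thterm k Om mu (boxpt delta Om s)).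
  by apply: cUC_thterm => i; apply: cUC_wpt => j; exact: UC_nth.
have UCfN a N : cUC (l + l) (fN a N).
  by apply: cUC_sum => mu _; apply: cUCM => //; exact: cUC_cst.
have UCFN N : cUC (l + l) (FN N).
  by apply: cUCM; [apply: cUCM => //; exact: cUC_conj|exact: cUC_realC].
have FN_cvg (e : R) : 0 < e -> exists N0, forall N, (N0 <= N)%N -> forall s, P s ->
    `|F s - FN N s| <= e%:C.
  (* Replacing the two factors in turn costs at most 2 e' K V; the added 1 keeps the denominator
     positive. *)
  move=> e0; pose e' := e / (2 * K * V + 1).
  have KV : 0 < 2 * K * V + 1 by rewrite ltr_wpDl// !mulr_ge0.
  have e'0 : 0 < e' by rewrite divr_gt0.
  have [N1 h1] := fN_cvg b bM _ e'0; have [N2 h2] := fN_cvg b' bM' _ e'0.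
  exists (maxn N1 N2) => N; rewrite geq_max => /andP[/h1 {}h1 /h2 {}h2] s sb.
  rewrite /F /FN; set x := Cab _ _ b _; set x' := Cab _ _ b' _.
  have -> : x^* * x' * (W s)%:C - (fN b N s)^* * fN b' N s * (W s)%:C =
      - ((fN b N s - x)^* * x' + (fN b N s)^* * (fN b' N s - x')) * (W s)%:C.
    by rewrite rmorphB /=; ring.
  have nW : `|(W s)%:C| <= V%:C :> C.
    by rewrite normc_def /= expr0n addr0 sqrtr_sqr lecR hV.
  rewrite normrM normrN (@le_trans _ _ ((e' * K + K * e')%:C * V%:C))//.
    have -> : (e' * K + K * e')%:C = e'%:C * K%:C + K%:C * e'%:C by rewrite rmorphD !rmorphM.
    rewrite ler_pM// (le_trans (ler_normD _ _))// lerD// normrM norm_conjC ler_pM//.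
    - exact: h1.
    - exact: Cab_le.
    - exact: fN_le.
    - exact: h2.
  rewrite -rmorphM lecR (_ : _ * V = e' * (2 * K * V)); last by ring.
  by rewrite -[leRHS](divfK (lt0r_neq0 KV)) ler_wpM2l ?(ltW e'0)// lerDl.
have UCF : cUC (l + l) F.
  apply: cUC_limit => e /FN_cvg[N0 /(_ _ (leqnn N0)) h].
  by exists (FN N0).
have FN_int N : cboxint (l + l) (FN N) =
    \sum_(mu <- boxset l N) (b mu)^* * b' mu * (gaussH k delta Om mu)%:C.
  pose T mu nu s : C := (b mu)^* * b' nu * ((thterm k Om mu (boxpt delta Om s))^* *
    thterm k Om nu (boxpt delta Om s) * (W s)%:C).
  have UC0 mu nu : cUC (l + l) (fun s => (thterm k Om mu (boxpt delta Om s))^* *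
      thterm k Om nu (boxpt delta Om s) * (W s)%:C).
    by apply: cUCM; [apply: cUCM => //; exact: cUC_conj|exact: cUC_realC].
  have UCT mu nu : cUC (l + l) (T mu nu) by apply: cUCM => //; exact: cUC_cst.
  transitivity (cboxint (l + l) (fun s =>
      \sum_(mu <- boxset l N) \sum_(nu <- boxset l N) T mu nu s)).
    apply: eq_cboxint => s _; rewrite /FN /fN rmorph_sum big_distrl /= mulr_suml.
    apply: eq_bigr => mu _; rewrite mulr_sumr mulr_suml; apply: eq_bigr => nu _.
    by rewrite /T rmorphM /=; ring.
  rewrite cboxint_sum => [|mu _]; last by apply: cUC_sum => nu _.
  rewrite [LHS]big_seq [RHS]big_seq; apply: eq_bigr => mu muN.
  rewrite cboxint_sum => [|nu _]; last exact: UCT.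
  (* By orthogonality only nu = mu survives in the inner sum. *)
  rewrite (big_fsetD1 mu muN)/= big1_fset ?addr0; last first.
    move=> nu; rewrite !inE => /andP[nm _] _; rewrite cboxintZ//.
    by rewrite cboxint_thterm// eq_sym (negbTE nm) mul0r mulr0.
  by rewrite cboxintZ// cboxint_thterm// eqxx mul1r.
rewrite ipHE -/F; apply/eqP; rewrite -subr_eq0 -normr_le0.
have := hsum_boxset (hsum_fund hb hb').
set I := ipI _ _ _ _ => hI.
suff small (e : R) : 0 < e -> `|cboxint (l + l) F - I| <= e%:C.
  have nz : `|cboxint (l + l) F - I| =
      (complex.Re `|cboxint (l + l) F - I|)%:C by rewrite normc_def.
  rewrite nz lecR; apply/ler_addgt0Pr => e e0; rewrite add0r -lecR -nz; exact: small.
move=> e0; have e30 : 0 < e / 3 by rewrite divr_gt0.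
have e30C : 0 < (e / 3)%:C by rewrite ltcR.
have [N1 h1] := FN_cvg _ e30; have [N2 h2] := hI _ e30C.
pose N := maxn N1 N2.
have {}h2 := h2 N (leq_maxr _ _); have {}h1 := h1 N (leq_maxl _ _).
(* Truncating the integrand costs 2 e / 3, truncating the limit sum e / 3. *)
have h3 := cboxint_close UCF (UCFN N) h1.
rewrite -FN_int in h2.
have -> : cboxint (l + l) F - I = (cboxint (l + l) F - cboxint (l + l) (FN N)) +
    (cboxint (l + l) (FN N) - I) by ring.
rewrite (le_trans (ler_normD _ _))// (le_trans (lerD h3 h2))// -rmorphD lecR.
by rewrite le_eqVlt; apply/orP; left; apply/eqP; field.
Qed.

End Unitarity.
Theorem theorem3p2 (R : realType) (l : nat) (hl : (0 < l)%N)
  (Om : 'M[R[i]]_l) (Om_sym : Om^T = Om)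
  (Om2_pd : forall v : 'cV[R]_l, v != 0 -> 0 < (v^T *m Omega2 Om *m v) 0 0)
  (delta : 'I_l -> nat) (delta_pos : forall i, (0 < delta i)%N)
  (delta_1 : forall i : 'I_l, val i = 0%N -> delta i = 1%N)
  (delta_dvd : forall i j : 'I_l, val j = (val i).+1 -> (delta i %| delta j)%N)
  (k : nat) (hk : (0 < k)%N) :
  (* (1) *)
  ((forall m : 'I_l -> int, Cab Om (k%:R)^-1 (theta0 k delta m) = theta k delta Om m)
   /\ (forall b, Ispace k delta b -> Hspace k delta Om (Cab Om (k%:R)^-1 b))
   /\ (forall f, Hspace k delta Om f ->
         exists2 b, Ispace k delta b & Cab Om (k%:R)^-1 b = f))
  (* (2) *)
  /\ (forall (j : 'I_l) (z : 'I_l -> R[i]),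
        nu Om (k%:R)^-1 (fun i => z i + evec j i) = nu Om (k%:R)^-1 z
        /\ nu Om (k%:R)^-1 (fun i => z i + Om i j * (delta j)%:R)
           = `| cexp (- (2%:R * pi%:C * 'i * k%:R * z j * (delta j)%:R)
                      - pi%:C * 'i * k%:R * Om j j * ((delta j)%:R ^+ 2)) | ^- 2
             * nu Om (k%:R)^-1 z)
  (* (3) C^{ab Omega}_{1/k} : (I, (.,.)) -> (H, <.,.>) is unitary *)
  /\ ((forall b b', Ispace k delta b -> Ispace k delta b' ->
         ipH k delta Om (Cab Om (k%:R)^-1 b) (Cab Om (k%:R)^-1 b') = ipI k delta b b')
      /\ (forall b b', Ispace k delta b -> Ispace k delta b' ->
         Cab Om (k%:R)^-1 b = Cab Om (k%:R)^-1 b' -> b = b')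
      /\ (forall f, Hspace k delta Om f ->
         exists2 b, Ispace k delta b & Cab Om (k%:R)^-1 b = f)).
Proof.
have surj f : Hspace k delta Om f -> exists2 b, Ispace k delta b & Cab Om (k%:R)^-1 b = f.
  move=> [s ->]; exists (fun mu => \sum_(x <- s) x.2 * theta0 k delta x.1 mu); first by exists s.
  exact: Cab_theta0_sum.
have Y_unit : Omega2 Om \in unitmx.
  have [dY _ _] := gaussbox_cvg (Omega2_sym Om_sym) Om2_pd.
  by rewrite unitmxE unitfE gt_eqF.
split; first split; last split.
- by move=> m; exact: Cab_theta0.
- split=> // b [s ->]; exists s; exact: Cab_theta0_sum.
- by move=> j z; split; [exact: nu_shift_evec|exact: nu_shift_Omega].
split; first by move=> b b'; exact: ipH_Cab.
split=> // b b' hb hb' Cbb'.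
(* The isometry turns equal images into the equalities of inner products that separate [b] from
   [b']. *)
have ip a a' := @ipH_Cab R l k delta Om hk delta_pos Om_sym Om2_pd a a'.
by apply: (ipI_separated hk delta_pos hb hb'); rewrite -!ip// Cbb'.
Qed.
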